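(* Let $\phi\colon\Omega\times\mathbb{R}^d\to\mathbb{R}\cup\{+\infty\}$ and $\psi\colon\Omega\times\mathbb{R}\to\mathbb{R}\cup\{+\infty\}$ be normal convex integrands for which the existence and strong duality assumption (see context) holds, with primal solution $u$ and dual solution $\mathbf{q}$. Suppose that $\phi$ and $\psi$ satisfy the Bregman--Young inequality with $\varepsilon$ (see context). Then there is a constant $C>0$, depending only on the constant from the Bregman--Young inequality with $\varepsilon$, such that the following holds. (i) If $v\in W^{1,1}(\mathcal{T}_h)$ and $\mathbf{r}$ is conforming, i.e. $\mathbf{r}\in W^1_N(\mathrm{div};\Omega)$, then $$\overline{\rho}^2_{\mathrm{tot}}(v,\mathbf{r})\le C\Big(\overline{\eta}^2(v,\mathbf{r})+\inf_{s\in W^{1,1}_D(\Omega)}\Big[\int_\Omega\mathcal{D}_\phi(G_hv,\nabla s)+\int_\Omega\mathcal{D}_\psi(v,s)\Big]\Big).$$ (ii) If $v$ is conforming, i.e. $v\in W^{1,1}_D(\Omega)$, and $\mathbf{r}\in W^1(\mathrm{div};\mathcal{T}_h)$, then $$\overline{\rho}^2_{\mathrm{tot}}(v,\mathbf{r})\le C\Big(\overline{\eta}^2(v,\mathbf{r})+\inf_{\mathbf{s}\in W^1_N(\mathrm{div};\Omega)}\Big[\int_\Omega\mathcal{D}_{\phi^*}(\mathbf{r},\mathbf{s})+\int_\Omega\mathcal{D}_{\psi^*}(\mathrm{div}_h\mathbf{r},\mathrm{div}\,\mathbf{s})\Big]\Big).$$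
   Context: **Domain and spaces.** $\Omega\subset\mathbb{R}^d$ is a bounded Lipschitz domain with a conforming shape-regular triangulation $\mathcal{T}_h$. Its boundary is split into relatively open disjoint parts $\Gamma_D,\Gamma_N$ such that $\partial\Omega\setminus(\Gamma_D\cup\Gamma_N)$ has zero $(d-1)$-dimensional measure, and each boundary facet of the triangulation is contained in either $\Gamma_D$ or $\Gamma_N$. For $p\in[1,\infty]$, $W^{1,p}_D(\Omega)$ is the set of $v\in W^{1,p}(\Omega)$ with zero trace on $\Gamma_D$. $W^1(\mathrm{div};\Omega)$ is the set of $\mathbf{r}\in L^1(\Omega)^d$ with $\mathrm{div}\,\mathbf{r}\in L^1(\Omega)$, and $W^1_N(\mathrm{div};\Omega)$ is the subset of those with $\int_\Omega(\mathbf{r}\cdot\nabla w+w\,\mathrm{div}\,\mathbf{r})=0$ for all $w\in W^{1,\infty}_D(\Omega)$. The broken spaces are $W^{1,1}(\mathcal{T}_h)=\{v\in L^1(\Omega):v|_T\in W^{1,1}(T)\ \forall T\in\mathcal{T}_h\}$ and $W^1(\mathrm{div};\mathcal{T}_h)=\{\mathbf{r}\in L^1(\Omega)^d:\mathbf{r}|_T\in W^1(\mathrm{div};T)\ \forall T\in\mathcal{T}_h\}$. **Discrete operators.** $G_h\colon W^{1,1}(\mathcal{T}_h)\to L^1(\Omega)^d$ and $\mathrm{div}_h\colon W^1(\mathrm{div};\mathcal{T}_h)\to L^1(\Omega)$ are given approximations of the gradient and divergence with $G_hv=\nabla v$ for all $v\in W^{1,1}(\Omega)$ and $\mathrm{div}_h\mathbf{r}=\mathrm{div}\,\mathbf{r}$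 for all $\mathbf{r}\in W^1(\mathrm{div};\Omega)$. **Integrands.** A normal convex integrand $\phi\colon\Omega\times\mathbb{R}^n\to\mathbb{R}\cup\{+\infty\}$ is convex (and proper) in the second variable, with closed-valued and measurable epigraphical mapping $x\mapsto\mathrm{epi}\,\phi(x,\cdot)$. Conjugates (denoted by $^*$) and subdifferentials are taken with respect to the second variable. For a convex $h$ on $\mathbb{R}^n$, $\mathrm{dom}\,h=\{h<+\infty\}$ and $\mathrm{dom}\,\partial h=\{\mathbf{a}:\partial h(\mathbf{a})\neq\emptyset\}$. **Existence and strong duality assumption.** Let $$I(v)=\int_\Omega\phi(\cdot,\nabla v)+\int_\Omega\psi(\cdot,v),\qquad D(\mathbf{r})=-\int_\Omega\phi^*(\cdot,\mathbf{r})-\int_\Omega\psi^*(\cdot,\mathrm{div}\,\mathbf{r}).$$ There exist $u\in W^{1,1}_D(\Omega)$ with $I(u)=\min_{W^{1,1}_D(\Omega)}I<+\infty$ and $\mathbf{q}\in W^1_N(\mathrm{div};\Omega)$ with $D(\mathbf{q})=\max_{W^1_N(\mathrm{div};\Omega)}D>-\infty$, and $I(u)=D(\mathbf{q})$. In this setting the optimality relations $\mathbf{q}\cdot\nabla u=\phi(\cdot,\nabla u)+\phi^*(\cdot,\mathbf{q})$ and $u\,\mathrm{div}\,\mathbf{q}=\psi(\cdot,u)+\psi^*(\cdot,\mathrm{div}\,\mathbf{q})$ are satisfied a.e. in $\Omega$. Equivalently, $\mathbf{q}\in\partial\phi(\cdot,\nabla u)$, $\nabla u\in\partial\phi^*(\cdot,\mathbf{q})$,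 $\mathrm{div}\,\mathbf{q}\in\partial\psi(\cdot,u)$, $u\in\partial\psi^*(\cdot,\mathrm{div}\,\mathbf{q})$ a.e. **Integrability convention.** Conforming functions $s\in W^{1,1}_D(\Omega)$ and $\mathbf{r}\in W^1_N(\mathrm{div};\Omega)$ are assumed to have the appropriate integrability to render finite the integrals in the relation $\int_\Omega(\mathbf{r}\cdot\nabla s+s\,\mathrm{div}\,\mathbf{r})=0$, which then holds for them. **Bregman divergences.** For a proper convex $h$ on $\mathbb{R}^n$, $\mathbf{b}\in\mathrm{dom}\,\partial h$, $\mathbf{g}\in\partial h(\mathbf{b})$, set $\mathcal{D}^{\mathbf{g}}_h(\mathbf{a},\mathbf{b})=h(\mathbf{a})-h(\mathbf{b})-\mathbf{g}\cdot(\mathbf{a}-\mathbf{b})\ge 0$. When the second argument comes from the exact solution, the omitted subgradients are the ones given by the optimality relations: $\mathcal{D}_\phi(\cdot,\nabla u)=\mathcal{D}^{\mathbf{q}}_\phi(\cdot,\nabla u)$, $\mathcal{D}_\psi(\cdot,u)=\mathcal{D}_\psi^{\mathrm{div}\,\mathbf{q}}(\cdot,u)$, $\mathcal{D}_{\phi^*}(\cdot,\mathbf{q})=\mathcal{D}_{\phi^*}^{\nabla u}(\cdot,\mathbf{q})$, $\mathcal{D}_{\psi^*}(\cdot,\mathrm{div}\,\mathbf{q})=\mathcal{D}_{\psi^*}^{u}(\cdot,\mathrm{div}\,\mathbf{q})$. For the divergences with second argument $\nabla s$, $s$, $\mathbf{s}$ or $\mathrm{div}\,\mathbf{s}$, any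 measurable selection of subgradients of the corresponding integrand at that argument may be used, and the bracket is $+\infty$ if no such selection exists. **Error measure and estimator.** $$\overline{\rho}^2_{\mathrm{tot}}(v,\mathbf{r})=\int_\Omega\big[\mathcal{D}_\phi(G_hv,\nabla u)+\mathcal{D}_\psi(v,u)+\mathcal{D}_{\phi^*}(\mathbf{r},\mathbf{q})+\mathcal{D}_{\psi^*}(\mathrm{div}_h\mathbf{r},\mathrm{div}\,\mathbf{q})\big],$$ $$\overline{\eta}^2(v,\mathbf{r})=\int_\Omega\big[\phi(\cdot,G_hv)-\mathbf{r}\cdot G_hv+\phi^*(\cdot,\mathbf{r})\big]+\int_\Omega\big[\psi(\cdot,v)-v\,\mathrm{div}_h\mathbf{r}+\psi^*(\cdot,\mathrm{div}_h\mathbf{r})\big].$$ **Bregman--Young inequality with $\varepsilon$.** A proper convex lower semicontinuous $h$ on $\mathbb{R}^n$ satisfies it if for every $\varepsilon>0$ there is $C_\varepsilon>0$ such that for all $\mathbf{a}_1\in\mathrm{dom}\,h$, $\mathbf{a}_2\in\mathrm{dom}\,\partial h$, $\mathbf{r}_1\in\mathrm{dom}\,h^*$, $\mathbf{r}_2,\mathbf{r}_3\in\mathrm{dom}\,\partial h^*$ with $\mathbf{a}_2\in\partial h^*(\mathbf{r}_2)$, and every $\mathbf{b}\in\partial h^*(\mathbf{r}_3)$, $$|(\mathbf{a}_1-\mathbf{a}_2)\cdot(\mathbf{r}_1-\mathbf{r}_3)|\le\varepsilon\big(\mathcal{D}_h^{\mathbf{r}_2}(\mathbf{a}_1,\mathbf{a}_2)+\mathcal{D}_{h^*}^{\mathbf{a}_2}(\mathbf{r}_1,\mathbf{r}_2)\big)+C_\varepsilon\,\mathcal{D}_{h^*}^{\mathbf{b}}(\mathbf{r}_1,\mathbf{r}_3).$$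 An integrand satisfies it if it holds for a.e. $x\in\Omega$ with constants $C_\varepsilon$ independent of $x$. *)

(* Defs.v *)
From HB Require Import structures.
From mathcomp Require Import all_boot all_order all_algebra.
From mathcomp Require Import all_classical all_reals all_analysis.

Set Implicit Arguments.
Unset Strict Implicit.
Unset Printing Implicit Defensive.
Import Order.TTheory GRing.Theory Num.Theory.
Import numFieldNormedType.Exports.

Local Open Scope classical_set_scope.
Local Open Scope ring_scope.

(* The ambient space R^d, d = n.+1, is 'rV[R]_n.+1.
   Functions are honest functions; elements of Lebesgue and Sobolev spaces are
   represented by representatives, and pointwise relations hold a.e. *)

Definition powerset_type (T : Type) : Type := T.

HB.instance Definition _ (T : pointedType) := Pointed.on (powerset_type T).
HB.instance Definition _ (T : pointedType) :=
  @isMeasurable.Build default_measure_display (powerset_type T)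
    setT I (fun _ _ => I) (fun _ _ => I).

Section cover_outer.
Context (R : realType) (T : pointedType) (w : set T -> \bar R).
Local Open Scope ereal_scope.

Definition cover_outer (X : set T) : \bar R :=
  ereal_inf [set \sum_(k <oo) w (F k) |
             F in [set F : (set T)^nat | X `<=` \bigcup_k F k]].

Hypotheses (w0 : w set0 = 0) (w_ge0 : forall X, 0 <= w X).

Lemma cover_outerE :
  cover_outer = mu_ext (w : set (powerset_type T) -> \bar R).
Proof.
apply/funext => X; rewrite /cover_outer /mu_ext; congr ereal_inf.
by apply/seteqP; split=> _ [F FX <-]; exists F => //; case: FX.
Qed.

Lemma cover_outer0 : cover_outer set0 = 0.
Proof. by rewrite cover_outerE; exact: mu_ext0. Qed.

Lemma cover_outer_ge0 X : 0 <= cover_outer X.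
Proof. by rewrite cover_outerE; exact: mu_ext_ge0. Qed.

Lemma le_cover_outer : {homo cover_outer : A B / A `<=` B >-> A <= B}.
Proof.
move=> A B AB; apply: ereal_inf_le_tmp => _ [F BF <-].
by exists F => //; exact: subset_trans AB BF.
Qed.

Lemma cover_outer_sigma_subadditive : sigma_subadditive cover_outer.
Proof.
rewrite cover_outerE.
exact: (@mu_ext_sigma_subadditive _ (powerset_type T) R w w_ge0).
Qed.

End cover_outer.

Definition vdot (R : realType) d (a b : 'rV[R]_d) : R :=
  \sum_i a 0 i * b 0 i.
Arguments vdot {R d} a b.

Definition sdot (R : realType) (a b : R) : R := a * b.
Arguments sdot {R} a b.

Definition enorm (R : realType) d (a : 'rV[R]_d) : R := Num.sqrt (vdot a a).

Section lebesgue.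
Context (R : realType) (n : nat).
Local Open Scope ereal_scope.

Definition box (a b : 'rV[R]_n.+1) : set 'rV[R]_n.+1 :=
  [set x | forall i, (a 0 i < x 0 i <= b 0 i)%R].

(* [ereal_inf set0 = +oo]: only boxes are used in the covers. *)
Definition box_volume (A : set 'rV[R]_n.+1) : \bar R :=
  ereal_inf [set (\prod_i (p.2 0 i - p.1 0 i))%:E |
    p in [set p : 'rV[R]_n.+1 * 'rV[R]_n.+1 |
          (forall i, (p.1 0 i <= p.2 0 i)%R) /\ A = box p.1 p.2]].

Lemma box_volume_ge0 A : 0 <= box_volume A.
Proof.
apply: le_ereal_inf_tmp => _ [p [p_le _] <-]; rewrite lee_fin.
by apply: prodr_ge0 => i _; rewrite subr_ge0.
Qed.

Lemma box_volume0 : box_volume set0 = 0.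
Proof.
apply/eqP; rewrite eq_le box_volume_ge0 andbT; apply: ereal_inf_lbound.
exists (0%R, 0%R); last by rewrite /= big_ord_recl subrr mul0r.
split=> //=; apply/seteqP; split=> // x /(_ ord0) /andP[/lt_le_trans lt /lt].
by rewrite ltxx.
Qed.

HB.instance Definition _ := isOuterMeasure.Build R _ (cover_outer box_volume)
  (cover_outer0 box_volume0 box_volume_ge0) (cover_outer_ge0 box_volume_ge0)
  (@le_cover_outer _ _ _)
  (cover_outer_sigma_subadditive box_volume_ge0).

Definition lebesgue_outer : {outer_measure set 'rV[R]_n.+1 -> \bar R} :=
  cover_outer box_volume.

(* n.+1-dimensional Lebesgue measure, on the (complete) sigma-algebra of
   Lebesgue measurable sets *)
Definition leb : {measure set (caratheodory_type lebesgue_outer) -> \bar R} :=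
  (lebesgue_outer : set (caratheodory_type lebesgue_outer) -> \bar R).

End lebesgue.
Arguments leb {R n}.
Notation leb_type R n := (caratheodory_type (@lebesgue_outer R n)).

Section hausdorff.
Context (R : realType) (d k : nat).
Local Open Scope ereal_scope.

Definition ediam (A : set 'rV[R]_d) : \bar R :=
  ereal_sup [set (enorm (p.1 - p.2))%:E | p in A `*` A].

Definition diam_weight (delta : R) (A : set 'rV[R]_d) : \bar R :=
  if A == set0 then 0
  else if ediam A <= delta%:E then ediam A ^+ k else +oo.

(* k-dimensional Hausdorff measure without the normalizing constant, which
   affects neither null sets nor L^1 convergence *)
Definition hausdorff_set (A : set 'rV[R]_d) : \bar R :=
  ereal_sup [set cover_outer (diam_weight delta) A |
             delta in [set delta : R | (0 < delta)%R]].

Lemma ediam_ge0 A : A !=set0 -> 0 <= ediam A.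
Proof.
move=> [x Ax]; apply: ereal_sup_ubound; exists (x, x) => //=.
rewrite subrr /enorm /vdot big1 ?sqrtr0// => i _.
by rewrite mxE mul0r.
Qed.

Lemma diam_weight_ge0 delta A : 0 <= diam_weight delta A.
Proof.
rewrite /diam_weight; have [//|/set0P A0] := eqVneq A set0.
by case: ifP => _; [apply: expe_ge0; exact: ediam_ge0 | exact: leey].
Qed.

Lemma diam_weight0 delta : diam_weight delta set0 = 0.
Proof. by rewrite /diam_weight eqxx. Qed.

Lemma hausdorff_set_ge0 A : 0 <= hausdorff_set A.
Proof.
apply: (@le_trans _ _ (cover_outer (diam_weight 1) A)).
  exact: cover_outer_ge0 (diam_weight_ge0 _) _.
by apply: ereal_sup_ubound; exists 1%R => //=; exact: ltr01.
Qed.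

Lemma hausdorff_set0 : hausdorff_set set0 = 0.
Proof.
apply/eqP; rewrite eq_le hausdorff_set_ge0 andbT.
apply: ge_ereal_sup => _ [delta _ <-].
by rewrite cover_outer0 ?diam_weight0//; exact: diam_weight_ge0.
Qed.

Lemma le_hausdorff_set : {homo hausdorff_set : A B / A `<=` B >-> A <= B}.
Proof.
move=> A B AB; apply: ge_ereal_sup => _ [delta delta0 <-].
apply: le_trans (le_cover_outer _ AB) _.
by apply: ereal_sup_ubound; exists delta.
Qed.

Lemma hausdorff_set_sigma_subadditive : sigma_subadditive hausdorff_set.
Proof.
move=> F; apply: ge_ereal_sup => _ [delta delta0 <-].
apply: le_trans (cover_outer_sigma_subadditive (diam_weight_ge0 _) _) _.
apply: lee_nneseries => i _ => [_|].
  exact: cover_outer_ge0 (diam_weight_ge0 _) _.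
by apply: ereal_sup_ubound; exists delta.
Qed.

HB.instance Definition _ := isOuterMeasure.Build R _ hausdorff_set
  hausdorff_set0 hausdorff_set_ge0 le_hausdorff_set
  hausdorff_set_sigma_subadditive.

Definition hausdorff_outer : {outer_measure set 'rV[R]_d -> \bar R} :=
  hausdorff_set.

Definition hausdorff :
    {measure set (caratheodory_type hausdorff_outer) -> \bar R} :=
  (hausdorff_outer : set (caratheodory_type hausdorff_outer) -> \bar R).

End hausdorff.
Arguments hausdorff {R d} k.

Definition bdry (T : topologicalType) (A : set T) : set T :=
  closure A `\` interior A.

(* Near each boundary point, in suitably rotated coordinates, the domain is the
   strict epigraph of a Lipschitz function of the first n coordinates. *)
Definition lipschitz_domain (R : realType) n (Omega : set 'rV[R]_n.+1) : Prop :=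
  [/\ open Omega, connected Omega, Omega !=set0, bounded_set Omega &
   forall x, bdry Omega x ->
     exists (Q : 'M[R]_n.+1) (g : 'rV[R]_n -> R) (L rad : R),
       [/\ Q *m Q^T = 1%:M,
           forall a b, `|g a - g b| <= L * enorm (a - b),
           0 < rad &
           forall y, enorm (y - x) < rad ->
             (Omega y <-> g (col' ord_max (y *m Q)) < (y *m Q) 0 ord_max)]].

Definition conv_hull (R : realType) d (A : set 'rV[R]_d) : set 'rV[R]_d :=
  [set y | exists (m : nat) (x : 'I_m -> 'rV[R]_d) (l : 'I_m -> R),
     [/\ forall i, A (x i), forall i, 0 <= l i, \sum_i l i = 1 &
         y = \sum_i l i *: x i]].

(* relative interior of the simplex with vertices [x] *)
Definition open_simplex (R : realType) d m (x : 'I_m -> 'rV[R]_d) :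
    set 'rV[R]_d :=
  [set y | exists l : 'I_m -> R,
     [/\ forall i, 0 < l i, \sum_i l i = 1 & y = \sum_i l i *: x i]].

Definition affinely_independent (R : realType) d m (x : 'I_m -> 'rV[R]_d) :=
  forall l : 'I_m -> R,
    \sum_i l i = 0 -> \sum_i l i *: x i = 0 -> forall i, l i = 0.

(* [Th i] lists the n.+2 vertices of the i-th element. *)
Definition conforming_triangulation (R : realType) n (Omega : set 'rV[R]_n.+1)
    N (Th : 'I_N -> 'I_n.+2 -> 'rV[R]_n.+1) : Prop :=
  [/\ forall i, affinely_independent (Th i),
      closure Omega = \bigcup_(i in [set: 'I_N]) conv_hull (range (Th i)),
      forall i j, i != j ->
        open_simplex (Th i) `&` open_simplex (Th j) = set0 &
      forall i j, i != j ->
        conv_hull (range (Th i)) `&` conv_hull (range (Th j)) =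
        conv_hull (range (Th i) `&` range (Th j))].

(* The diameter of each element is at most [sigma] times the radius of some
   ball it contains. *)
Definition shape_regular (R : realType) n (sigma : R)
    N (Th : 'I_N -> 'I_n.+2 -> 'rV[R]_n.+1) : Prop :=
  forall i, exists (x : 'rV[R]_n.+1) (rad : R),
    [/\ 0 < rad,
        forall y, enorm (y - x) <= rad -> conv_hull (range (Th i)) y &
        (ediam (conv_hull (range (Th i))) <= (sigma * rad)%:E)%E].

Definition boundary_partition (R : realType) n
    (Omega GammaD GammaN : set 'rV[R]_n.+1) : Prop :=
  [/\ exists2 U, open U & GammaD = bdry Omega `&` U,
      exists2 U, open U & GammaN = bdry Omega `&` U,
      GammaD `&` GammaN = set0 &
      hausdorff n (bdry Omega `\` (GammaD `|` GammaN)) = 0%E].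

(* Facets are taken relatively open, since GammaD and GammaN are. *)
Definition facets_compatible (R : realType) n
    (Omega GammaD GammaN : set 'rV[R]_n.+1)
    N (Th : 'I_N -> 'I_n.+2 -> 'rV[R]_n.+1) : Prop :=
  forall i (k : 'I_n.+2), let facet := open_simplex (fun j : 'I_n.+1 => Th i (lift k j)) in
    facet `<=` bdry Omega -> facet `<=` GammaD \/ facet `<=` GammaN.

Section sobolev.
Context (R : realType) (n : nat).
Local Notation space := 'rV[R]_n.+1.
Implicit Types (Omega : set space) (v f eta : space -> R) (r g : space -> space).

Definition pderiv (i : 'I_n.+1) f (x : space) : R := 'D_(delta_mx 0 i) f x.

Fixpoint Ck (k : nat) f : Prop :=
  continuous f /\
  if k is k'.+1 then
    forall i, (forall x, derivable f x (delta_mx 0 i)) /\ Ck k' (pderiv i f)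
  else True.

Definition smooth f : Prop := forall k, Ck k f.

Definition test_function Omega eta : Prop :=
  let supp := closure [set x | eta x != 0] in
  [/\ smooth eta, compact supp & supp `<=` Omega].

Definition Lp (p : \bar R) Omega v : Prop :=
  measurable_fun (Omega : set (leb_type R n)) (v : leb_type R n -> R) /\
  (Lnorm leb p ((EFin \o v) \_ Omega) < +oo)%E.

Definition Lp_vec p Omega r : Prop := forall i, Lp p Omega (fun x => r x 0 i).

Definition measurable_vec Omega r : Prop := forall i,
  measurable_fun (Omega : set (leb_type R n))
    ((fun x => r x 0 i) : leb_type R n -> R).

Definition is_grad Omega v g : Prop :=
  [/\ Lp 1 Omega v, Lp_vec 1 Omega g &
   forall eta, test_function Omega eta -> forall i,
     \int[leb]_(x in Omega) (v x * pderiv i eta x) =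
     - \int[leb]_(x in Omega) (g x 0 i * eta x)].

Definition is_div Omega r f : Prop :=
  [/\ Lp_vec 1 Omega r, Lp 1 Omega f &
   forall eta, test_function Omega eta ->
     \int[leb]_(x in Omega) (\sum_i r x 0 i * pderiv i eta x) =
     - \int[leb]_(x in Omega) (f x * eta x)].

(* The weak gradient and divergence, which are unique up to null sets; 0 when
   they do not exist. *)
Definition grad Omega v : space -> space := xget (fun=> 0) (is_grad Omega v).
Definition div Omega r : space -> R := xget (fun=> 0) (is_div Omega r).

(* p >= 1 and bounded Omega are understood, so that L^p is contained in L^1 *)
Definition W1 (p : \bar R) Omega v : Prop :=
  [/\ Lp p Omega v, exists g, is_grad Omega v g & Lp_vec p Omega (grad Omega v)].

Definition Wdiv Omega r : Prop := exists f, is_div Omega r f.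

(* Graph of the trace operator from W^{1,1}(Omega) to L^1(bdry Omega), the
   closure of w |-> w|_(bdry Omega) on functions smooth up to the boundary *)
Definition is_trace Omega v (t : space -> R) : Prop :=
  (hausdorff n).-integrable (bdry Omega) (EFin \o t) /\
  exists w : (space -> R)^nat,
    [/\ forall m, smooth (w m),
        \int[leb]_(x in Omega) `|(w m x - v x)%:E| @[m --> \oo] --> 0%E,
        forall i, \int[leb]_(x in Omega)
          `|(pderiv i (w m) x - grad Omega v x 0 i)%:E| @[m --> \oo] --> 0%E &
        \int[hausdorff n]_(x in bdry Omega)
          `|(w m x - t x)%:E| @[m --> \oo] --> 0%E]%E.

Definition W1D (p : \bar R) Omega (GammaD : set space) v : Prop :=
  W1 p Omega v /\
  exists2 t, is_trace Omega v t &
    {ae hausdorff n, forall x, GammaD x -> t x = 0}.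

Definition W1N Omega (GammaD : set space) r : Prop :=
  Wdiv Omega r /\
  forall w, W1D +oo Omega GammaD w ->
    \int[leb]_(x in Omega) (vdot (r x) (grad Omega w x) + w x * div Omega r x)
    = 0.

Definition broken_W11 Omega N (Th : 'I_N -> 'I_n.+2 -> space) v : Prop :=
  Lp 1 Omega v /\ forall i, W1 1 (open_simplex (Th i)) v.

Definition broken_Wdiv Omega N (Th : 'I_N -> 'I_n.+2 -> space) r : Prop :=
  Lp_vec 1 Omega r /\ forall i, Wdiv (open_simplex (Th i)) r.

Definition discrete_grad Omega N (Th : 'I_N -> 'I_n.+2 -> space)
    (Gh : (space -> R) -> space -> space) : Prop :=
  [/\ forall v, broken_W11 Omega Th v -> Lp_vec 1 Omega (Gh v),
      forall v v', broken_W11 Omega Th v -> broken_W11 Omega Th v' ->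
        {ae leb, forall x, Omega x -> v x = v' x} ->
        {ae leb, forall x, Omega x -> Gh v x = Gh v' x} &
      forall v, W1 1 Omega v ->
        {ae leb, forall x, Omega x -> Gh v x = grad Omega v x}].

Definition discrete_div Omega N (Th : 'I_N -> 'I_n.+2 -> space)
    (divh : (space -> space) -> space -> R) : Prop :=
  [/\ forall r, broken_Wdiv Omega Th r -> Lp 1 Omega (divh r),
      forall r r', broken_Wdiv Omega Th r -> broken_Wdiv Omega Th r' ->
        {ae leb, forall x, Omega x -> r x = r' x} ->
        {ae leb, forall x, Omega x -> divh r x = divh r' x} &
      forall r, Wdiv Omega r ->
        {ae leb, forall x, Omega x -> divh r x = div Omega r x}].

(* Standing integrability convention for a pair of conforming functions: a
   W^{1,1} function and an L^1 field need not have an integrable product, nor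
   satisfy the relation below. *)
Definition parts_relation Omega (s : space -> R) r : Prop :=
  let f x := vdot (r x) (grad Omega s x) + s x * div Omega r x in
  leb.-integrable Omega (EFin \o f) /\ (\int[leb]_(x in Omega) (f x)%:E = 0)%E.

End sobolev.

(* [E] with the inner product [dot] is either 'rV[R]_d with [vdot], or R with
   [sdot]. *)
Section convex.
Context (R : realType) (E : normedModType R) (dot : E -> E -> R).
Local Open Scope ereal_scope.
Implicit Types (h : E -> \bar R) (a b g : E).

Definition conj h (g : E) : \bar R :=
  ereal_sup [set (dot g a)%:E - h a | a in [set: E]].

Definition subdiff h (b : E) : set E :=
  [set g | forall a, h b + (dot g (a - b)%R)%:E <= h a].

Definition dom h : set E := [set a | h a < +oo].

Definition dom_subdiff h : set E := [set a | subdiff h a !=set0].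

Definition epi h : set (E * R) := [set p | h p.1 <= p.2%:E].

Definition proper_fun h : Prop :=
  (forall a, h a != -oo) /\ exists a, h a < +oo.

Definition convex_fun h : Prop := forall a b (t : R), (0 <= t <= 1)%R ->
  h (t *: a + (1 - t) *: b)%R <= t%:E * h a + (1 - t)%:E * h b.

Definition bregman h (g a b : E) : \bar R :=
  h a - h b - (dot g (a - b)%R)%:E.

Definition bregman_young (Ceps : R -> R) h : Prop :=
  forall eps : R, (0 < eps)%R ->
  forall a1 a2 r1 r2 r3 b,
    dom h a1 -> dom_subdiff h a2 ->
    dom (conj h) r1 -> dom_subdiff (conj h) r2 -> dom_subdiff (conj h) r3 ->
    subdiff (conj h) r2 a2 -> subdiff (conj h) r3 b ->
    `|(dot (a1 - a2)%R (r1 - r3)%R)%:E| <=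
      eps%:E * (bregman h r2 a1 a2 + bregman (conj h) a2 r1 r2)
      + (Ceps eps)%:E * bregman (conj h) b r1 r3.

Context (n : nat) (Omega : set 'rV[R]_n.+1).
Implicit Types phi : 'rV[R]_n.+1 -> E -> \bar R.

Definition normal_convex_integrand phi : Prop :=
  (forall x, Omega x ->
    [/\ proper_fun (phi x), convex_fun (phi x) & closed (epi (phi x))]) /\
  (forall O : set (E * R), open O ->
    measurable ([set x | Omega x /\ epi (phi x) `&` O !=set0]
                : set (leb_type R n))).

Definition integrand_bregman_young (Ceps : R -> R) phi : Prop :=
  {ae leb, forall x, Omega x -> bregman_young Ceps (phi x)}.

Definition subgradient_selection phi (b g : 'rV[R]_n.+1 -> E) : Prop :=
  {ae leb, forall x, Omega x -> subdiff (phi x) (b x) (g x)}.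

End convex.

Section problem.
Context (R : realType) (n : nat) (Omega GammaD : set 'rV[R]_n.+1).
Local Notation space := 'rV[R]_n.+1.
Context (phi : space -> space -> \bar R) (psi : space -> R -> \bar R).
Local Open Scope ereal_scope.
Implicit Types (u v : space -> R) (q r : space -> space).

(* Integral functionals of convex analysis take the value +oo as soon as the
   positive part has infinite integral, so +oo dominates -oo in sums: this is
   the dual addition, used in the next three definitions. *)
Definition upper_integral (f : space -> \bar R) : \bar R :=
  (\int[leb]_(x in Omega) f^\+ x + - \int[leb]_(x in Omega) f^\- x)%dE.

Definition primal v : \bar R :=
  (upper_integral (fun x => phi x (grad Omega v x))
   + upper_integral (fun x => psi x (v x)))%dE.

Definition dual r : \bar R :=
  - (upper_integral (fun x => conj vdot (phi x) (r x))
     + upper_integral (fun x => conj sdot (psi x) (div Omega r x)))%dE.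

Definition strong_duality u q : Prop :=
  [/\ W1D 1 Omega GammaD u /\ W1N Omega GammaD q,
      (forall v, W1D 1 Omega GammaD v -> primal u <= primal v) /\
        primal u < +oo,
      (forall r, W1N Omega GammaD r -> dual r <= dual q) /\ -oo < dual q &
      primal u = dual q].

Definition rho_tot2 (Gh : (space -> R) -> space -> space)
    (divh : (space -> space) -> space -> R) u q v r : \bar R :=
  \int[leb]_(x in Omega)
    (bregman vdot (phi x) (q x) (Gh v x) (grad Omega u x)
     + bregman sdot (psi x) (div Omega q x) (v x) (u x)
     + bregman vdot (conj vdot (phi x))
         (grad Omega u x) (r x) (q x)
     + bregman sdot (conj sdot (psi x)) (u x) (divh r x) (div Omega q x)).

Definition eta2 (Gh : (space -> R) -> space -> space)
    (divh : (space -> space) -> space -> R) v r : \bar R :=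
  \int[leb]_(x in Omega)
    (phi x (Gh v x) - (vdot (r x) (Gh v x))%:E
     + conj vdot (phi x) (r x))
  + \int[leb]_(x in Omega)
    (psi x (v x) - (v x * divh r x)%:E + conj sdot (psi x) (divh r x)).

(* Values of the bracket in the first estimate, over all conforming s that obey
   the integrability convention with the fields r and q they are paired with,
   and all measurable selections of subgradients; the infimum of the empty set
   is +oo. *)
Definition primal_brackets (Gh : (space -> R) -> space -> space) q v r :
    set (\bar R) :=
  [set B | exists (s : space -> R) (g : space -> space) (k : space -> R),
    [/\ W1D 1 Omega GammaD s,
        parts_relation Omega s r /\ parts_relation Omega s q,
        measurable_vec Omega g /\
          subgradient_selection vdot Omega phi (grad Omega s) g,
        measurable_fun (Omega : set (leb_type R n)) (k : leb_type R n -> R) /\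
          subgradient_selection sdot Omega psi s k &
        B = \int[leb]_(x in Omega)
              bregman vdot (phi x) (g x) (Gh v x) (grad Omega s x)
            + \int[leb]_(x in Omega) bregman sdot (psi x) (k x) (v x) (s x)]].

Definition dual_brackets (divh : (space -> space) -> space -> R) u v r :
    set (\bar R) :=
  [set B | exists (s : space -> space) (g : space -> space) (k : space -> R),
    [/\ W1N Omega GammaD s,
        parts_relation Omega v s /\ parts_relation Omega u s,
        measurable_vec Omega g /\
          subgradient_selection vdot Omega
            (fun x => conj vdot (phi x)) s g,
        measurable_fun (Omega : set (leb_type R n)) (k : leb_type R n -> R) /\
          subgradient_selection sdot Omega (fun x => conj sdot (psi x))
            (div Omega s) k &
        B = \int[leb]_(x in Omega)
              bregman vdot (conj vdot (phi x))
                (g x) (r x) (s x)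
            + \int[leb]_(x in Omega)
              bregman sdot (conj sdot (psi x))
                (k x) (divh r x) (div Omega s x)]].

End problem.

(* Main.v *)
Require Import Defs.
From HB Require Import structures.
From mathcomp Require Import all_boot all_order all_algebra.
From mathcomp Require Import all_classical all_reals all_analysis.
From mathcomp Require Import measurable_realfun.
From mathcomp Require Import ring lra.
Set Implicit Arguments.
Unset Strict Implicit.
Unset Printing Implicit Defensive.
Import Order.TTheory GRing.Theory Num.Theory.
Import numFieldNormedType.Exports.
Local Open Scope classical_set_scope.
Local Open Scope ring_scope.

(** Write gap(a,r) = h(a) + h*(r) - r.a for the Fenchel gap of a convex h; it is
    nonnegative and vanishes exactly when r is a subgradient of h at a.  When r
    is a subgradient of h at a, both D_h^r(a',a) = gap(a',r) and
    D_h*^a(r',r) = gap(a,r').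

    The error is controlled pointwise.  Let (a2,r2) be the exact pair (a
    subgradient pair, by the optimality relations), (a1,r1) the approximations.
    Expanding the gaps gives
      gap(a1,r2) + gap(a2,r1) = gap(a1,r1) + (a1 - a2).(r1 - r2),
    that is: error density = estimator density + a pairing.  If the pairing were
    between conforming functions it would integrate to zero, after summation
    over the two integrands.  A conforming s is therefore inserted, and only the
    part containing the nonconforming quantity minus s has to be absorbed.

    If v is conforming, the part to absorb is (a1 - a2).(r1 - s), and this is
    literally the left-hand side of the Bregman--Young inequality.  If r is
    conforming, it is (a1 - b).(r1 - r2) with b the value of grad s or of s,
    where the roles of h and h* are exchanged.  The inequality for h is not
    symmetric in h and h*, so it has to be transferred.  The steps are:
    - it makes the gap quasi-symmetric on subgradient pairs
      ([gap_quasi_symmetric]);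
    - with parameter 1/2 and a third pair chosen at (a,r), it yields
        (a - b).(s - S) <= theta gap(b,s) + M gap(a,S)
      with some theta < 1 depending only on the constants
      ([weighted_young_start]);
    - such an inequality self-improves: it bounds h at the dilated point
      b + (a - b)/theta, where it can be applied again, so that theta may be
      replaced by any power of it ([weighted_young_comp]).
    With theta = 1/2 this absorbs the pairing ([primal_estimate]).  Points of
    the domain without subgradient, and dilated points, are approached by
    subgradient pairs produced by proximal minimization ([resolvent]); these
    pairs keep the gap under control ([near_graph]), which replaces any
    discussion of relative interiors or of the biconjugate.

    The remaining work is integration.  Composites of normal integrands and of
    their conjugates with measurable functions are measurable
    ([measurable_integrand], [measurable_conj_integrand]).  The optimality
    relations follow from strong duality since the two Fenchel gaps of the
    exact pair are nonnegative with vanishing total integral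
    ([strong_duality_subdiff]).  Finally [error_estimate] integrates the
    pointwise bounds, the conforming pairing having mean zero. *)

(** * Inner products *)

(** The properties shared by the Euclidean product of row vectors and the
    product of scalars; the vector-valued and the scalar integrand are treated
    together over any space with such a product. *)
Record euclidean {R : realType} {E : normedModType R} (dot : E -> E -> R) :
    Prop := Euclidean {
  dotC : forall x y, dot x y = dot y x;
  dotDl : forall x y z, dot (x + y) z = dot x z + dot y z;
  dotZl : forall t x y, dot (t *: x) y = t * dot x y;
  dot_ge0 : forall x, 0 <= dot x x;
  dot_continuous : continuous (fun p : E * E => dot p.1 p.2);
  dot_compact : forall M, compact [set x | dot x x <= M];
  dense_sequence : exists c : nat -> E,
    forall x (e : R), 0 < e -> exists i, ball x e (c i)
}.

(** Limits are taken below in this form: an error term of arbitrarily small size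
    is dropped. *)
Lemma ler_affine_right (R : realFieldType) (a b c : R) :
  (forall t, 0 < t -> t <= 1 -> a <= b + t * c) -> a <= b.
Proof.
move=> H; rewrite leNgt; apply/negP => ba.
have d0 : 0 < a - b by rewrite subr_gt0.
have c0 : 0 < `|c| + (a - b) by rewrite ltr_wpDl.
have t1 : (a - b) / (2 * (`|c| + (a - b))) <= 1.
  rewrite ler_pdivrMr ?mulr_gt0// mul1r; have := normr_ge0 c; lra.
have t0 : 0 < (a - b) / (2 * (`|c| + (a - b))) by rewrite divr_gt0// mulr_gt0.
have := H _ t0 t1; set t := (a - b) / _ in t0 t1 *.
have tE : t * (2 * (`|c| + (a - b))) = a - b.
  by rewrite /t divfK// gt_eqF// mulr_gt0.
have : t * c <= t * `|c| by rewrite ler_pM2l// ler_norm.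
nra.
Qed.

Section dot.
Context {R : realType} {E : normedModType R} {dot : E -> E -> R}.
Hypothesis euc : euclidean dot.

Lemma dotDr x y z : dot x (y + z) = dot x y + dot x z.
Proof. by rewrite !(dotC euc x) (dotDl euc). Qed.

Lemma dotZr t x y : dot x (t *: y) = t * dot x y.
Proof. by rewrite !(dotC euc x) (dotZl euc). Qed.

Lemma dotNl x y : dot (- x) y = - dot x y.
Proof. by rewrite -scaleN1r (dotZl euc) mulN1r. Qed.

Lemma dotNr x y : dot x (- y) = - dot x y.
Proof. by rewrite dotC// dotNl dotC. Qed.

Lemma dotBl x y z : dot (x - y) z = dot x z - dot y z.
Proof. by rewrite (dotDl euc) dotNl. Qed.

Lemma dotBr x y z : dot x (y - z) = dot x y - dot x z.
Proof. by rewrite dotDr dotNr. Qed.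

Lemma dot_young (k : R) x y : 0 < k ->
  dot x y <= (k^-1 * dot x x + k * dot y y) / 2.
Proof.
move=> k0; have := dot_ge0 euc (x - k *: y).
rewrite dotBl !dotBr !(dotZl euc) !dotZr (dotC euc y x).
set a := dot x x; set b := dot y y; set c := dot x y => H.
rewrite -subr_ge0.
have -> : (k^-1 * a + k * b) / 2 - c =
   k^-1 * (a - k * c - (k * c - k * (k * b))) / 2 by field; lra.
by rewrite divr_ge0// mulr_ge0// invr_ge0 ltW.
Qed.

End dot.

(** * Fenchel gaps of a convex function *)

(** Real-valued version; it is meaningful when a and r belong to the domains of
    h and of its conjugate, and the values of [fine] elsewhere are never
    relied upon. *)
Definition fenchel_gap {R : realType} {E : normedModType R} (dot : E -> E -> R)
  (h : E -> \bar R) (a r : E) : R :=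
  fine (h a) + fine (conj dot h r) - dot r a.

Section convex.
Context {R : realType} {E : normedModType R} {dot : E -> E -> R}.
Context {h : E -> \bar R}.
Hypothesis euc : euclidean dot.
Hypothesis h_proper : proper_fun h.
Hypothesis h_convex : convex_fun h.
Hypothesis h_closed : closed (epi h).

Local Notation gap := (fenchel_gap dot h).
Local Notation hs := (conj dot h).

Lemma dom_finE {a} : dom h a -> h a = (fine (h a))%:E.
Proof.
move=> ha; rewrite fineK// fin_numE (h_proper.1 a) /=.
by move: ha; rewrite /dom /= ltey.
Qed.

Lemma conj_geB a r : ((dot r a)%:E - h a <= hs r)%E.
Proof. by apply: ereal_sup_ubound; exists a. Qed.

Lemma conj_neqNy r : hs r != -oo%E.
Proof.
have [a ha] := h_proper.2; have := conj_geB a r.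
rewrite (@dom_finE a ha); apply: contraTneq => ->.
by rewrite -EFinB leNgt ltNyr.
Qed.

Lemma dom_conj_finE {r} : dom hs r -> hs r = (fine (hs r))%:E.
Proof.
move=> hr; rewrite fineK// fin_numE conj_neqNy /=.
by move: hr; rewrite /dom /= ltey.
Qed.

Lemma gap_ge0 a r : dom h a -> dom hs r -> 0 <= gap a r.
Proof.
move=> ha hr; have := conj_geB a r; rewrite (dom_finE ha) (dom_conj_finE hr).
rewrite -EFinB lee_fin /fenchel_gap; lra.
Qed.

Lemma subdiff_dom {a r} : subdiff dot h a r -> dom h a.
Proof.
move=> har; have [b hb] := h_proper.2.
have := har b; rewrite /dom /= (@dom_finE b hb) ltey.
by apply: contraTneq => ->; rewrite addye// -ltNge ltry.
Qed.

Lemma subdiff_conj {a r} : subdiff dot h a r -> hs r = (dot r a - fine (h a))%:E.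
Proof.
move=> har; have ha := subdiff_dom har.
apply/eqP; rewrite eq_le; apply/andP; split; last first.
  by rewrite EFinB -(dom_finE ha); exact: conj_geB.
apply: ge_ereal_sup => _ [b _ <-]; have := har b.
have [hb|] := boolP (h b < +oo)%E; last first.
  by rewrite ltey negbK => /eqP ->; rewrite addeNy leNye.
rewrite (@dom_finE b hb) (dom_finE ha) -EFinD !lee_fin (dotBr euc); lra.
Qed.

Lemma subdiff_dom_conj {a r} : subdiff dot h a r -> dom hs r.
Proof. by move=> /subdiff_conj; rewrite /dom /= => ->; rewrite ltry. Qed.

Lemma gap_subdiff {a r} : subdiff dot h a r -> gap a r = 0.
Proof. by move=> har; rewrite /fenchel_gap (subdiff_conj har) /=; lra. Qed.

Lemma subdiff_gap {a r} : dom h a -> dom hs r -> gap a r = 0 ->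
  subdiff dot h a r.
Proof.
move=> ha hr ar0 b.
have [hb|] := boolP (h b < +oo)%E; last first.
  by rewrite ltey negbK => /eqP ->; rewrite leey.
have := gap_ge0 hb hr; move: ar0; rewrite /fenchel_gap (@dom_finE b hb) (dom_finE ha).
rewrite -EFinD lee_fin (dotBr euc) /=; lra.
Qed.

Lemma subdiff_conjC {a r} : subdiff dot h a r -> subdiff dot hs r a.
Proof.
move=> har s; have ha := subdiff_dom har.
have [hs'|] := boolP (hs s < +oo)%E; last first.
  by rewrite ltey negbK => /eqP ->; rewrite leey.
have := gap_ge0 ha hs'; rewrite /fenchel_gap (subdiff_conj har) (dom_conj_finE hs').
rewrite -EFinD lee_fin (dotBr euc) !(dotC euc a) /=; lra.
Qed.

(** The terms in h and in its conjugate cancel in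
    gap(a,s) + gap(b,r) - gap(a,r) - gap(b,s), which leaves a bilinear
    expression.  This identity plays the part of the three-point identity for
    Bregman divergences. *)
Lemma gap_exchange a r b s : subdiff dot h b s ->
  gap a s + gap b r = gap a r + dot (a - b) (r - s).
Proof.
move=> /gap_subdiff; rewrite /fenchel_gap (dotBl euc) !(dotBr euc).
rewrite !(dotC euc a) !(dotC euc b); lra.
Qed.

Lemma bregmanE a b s : dom h a -> subdiff dot h b s ->
  bregman dot h s a b = (gap a s)%:E.
Proof.
move=> ha hbs; rewrite /bregman (dom_finE ha) (dom_finE (subdiff_dom hbs)).
rewrite -!EFinB; congr EFin; have := gap_subdiff hbs.
rewrite /fenchel_gap (dotBr euc) /=; lra.
Qed.

Lemma bregman_conjE r b s : dom hs r -> subdiff dot h b s ->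
  bregman dot hs b r s = (gap b r)%:E.
Proof.
move=> hr hbs; rewrite /bregman (dom_conj_finE hr).
rewrite (dom_conj_finE (subdiff_dom_conj hbs)).
rewrite -!EFinB; congr EFin; have := gap_subdiff hbs.
rewrite /fenchel_gap (dotBr euc) !(dotC euc b) /=; lra.
Qed.

Lemma epi_dom a y : epi h (a, y) -> dom h a /\ fine (h a) <= y.
Proof.
rewrite /epi /= => hy; have ha : dom h a.
  by rewrite /dom /=; apply: (le_lt_trans hy); rewrite ltry.
by split=> //; move: hy; rewrite (@dom_finE a ha) lee_fin.
Qed.

Lemma dom_epi a : dom h a -> epi h (a, fine (h a)).
Proof. by move=> ha; rewrite /epi /= -(@dom_finE a ha). Qed.

Lemma dot_shift_continuous (c w : E) :
  continuous (fun p : E * R => dot w p.1) /\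
  continuous (fun p : E * R => dot (p.1 - c) (p.1 - c)).
Proof.
split=> p.
  apply: (@continuous_comp _ _ _ (fun p : E * R => (w, p.1))
    (fun p : E * E => dot p.1 p.2)); last exact: (dot_continuous euc).
  by apply: cvg_pair => //=; [exact: cvg_cst | exact: cvg_fst].
apply: (@continuous_comp _ _ _ (fun p : E * R => (p.1 - c, p.1 - c))
    (fun p : E * E => dot p.1 p.2)); last exact: (dot_continuous euc).
by apply: cvg_pair => //=; apply: cvgB; [exact: cvg_fst|exact: cvg_cst|exact: cvg_fst|exact: cvg_cst].
Qed.

(** * Proximal points and density of subgradient pairs *)

(** The functional G is minimized over pairs (x,y) of the epigraph instead of
    points x: it is then continuous, and lower semicontinuity of h enters only
    as closedness of the epigraph.  Coercivity comes from the quadratic term,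
    as y - S.x is bounded below by - h*(S). *)
Lemma prox_minimizer c S tau : 0 < tau -> dom hs S ->
  exists2 A, dom h A &
    let G x y := y - dot S x + (2 * tau)^-1 * dot (x - c) (x - c) in
    forall x, dom h x -> forall y, fine (h x) <= y -> G A (fine (h A)) <= G x y.
Proof.
move=> tau0 hS; have [x0 hx0] := h_proper.2.
pose G (p : E * R) := p.2 - dot S p.1 + (2 * tau)^-1 * dot (p.1 - c) (p.1 - c).
have cG : continuous G.
  have [c1 c2] := dot_shift_continuous c S.
  move=> p; apply: cvgD; first by apply: cvgB; [exact: cvg_snd|exact: c1].
  by apply: cvgM; [exact: cvg_cst|exact: c2].
set al := G (x0, fine (h x0)).
pose K := epi h `&` [set p | G p <= al].
pose s := fine (hs S).
have lb a y : epi h (a, y) -> - s <= y - dot S a.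
  move=> /epi_dom[ha hay]; have := gap_ge0 ha hS.
  by rewrite /fenchel_gap /s; lra.
have tau2 : 0 < (2 * tau)^-1 by rewrite invr_gt0 mulr_gt0.
have tauE : (2 * tau)^-1 * (2 * tau) = 1 by rewrite mulVf// gt_eqF// mulr_gt0.
(* |a|^2 <= 2 |a - c|^2 + 2 |c|^2, and |a - c|^2 <= 2 tau (al + s) below the
   level al *)
set M := 2 * (2 * tau * (al + s)) + 2 * dot c c.
set T := (dot S S + M) / 2.
have KM p : K p -> dot p.1 p.1 <= M /\ - s - T <= p.2 <= al + T.
  case: p => a y [/= hay Gp]; have la := lb _ _ hay; move: Gp; rewrite /G /=.
  set d := dot (a - c) (a - c) => Gp.
  have d0 : 0 <= d by exact: dot_ge0.
  have dle : d <= 2 * tau * (al + s).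
    by rewrite -(ler_pM2l tau2) mulrA tauE mul1r; lra.
  have aM : dot a a <= M.
    have := dot_ge0 euc (a - c - c).
    rewrite {1}(dotBl euc) !(dotBr euc _ _ c) -/d.
    move: dle; rewrite /M /d !(dotBl euc) !(dotBr euc) !(dotC euc c a).
    lra.
  have := dot_young euc S a ltr01; rewrite invr1 !mul1r => y1.
  have := dot_young euc (- S) a ltr01.
  rewrite invr1 !mul1r !(dotNl euc) (dotNr euc) opprK => y2.
  split => //; apply/andP; rewrite /T; split; first by lra.
  by have := mulr_ge0 (ltW tau2) d0; lra.
have Kx0 : K (x0, fine (h x0)).
  by split; [exact: dom_epi | rewrite /= lexx].
have cK : compact K.
  apply: (@subclosed_compact _ _ ([set x | dot x x <= M] `*` `[- s - T, al + T]%classic)).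
  - apply: closedI => //.
    apply: (@closed_comp _ _ G [set x | x <= al]); last exact: closed_le.
    by move=> x _; exact: cG.
  - by apply: compact_setX; [exact: dot_compact|exact: segment_compact].
  - by move=> p /KM[p1 p2]; split => //=; rewrite in_itv.
have [p pK pmin] := compact_EVT_min (ex_intro _ _ Kx0) cK
  (continuous_subspaceT cG).
move: p pK pmin => [A y] /[!inE] -[/= epA Gal] pmin.
have [hA hAy] := epi_dom epA.
exists A => // x hx z hz.
have exz : epi h (x, z) by rewrite /epi /= (dom_finE hx) lee_fin.
apply: (@le_trans _ _ (G (A, y))); first by rewrite /G /= !lerD2r.
have [Gz|Gz] := leP (G (x, z)) al; last by rewrite (le_trans Gal)// ltW.
by apply: (pmin (x, z)); rewrite inE; split.
Qed.

(** First-order condition for the proximal minimizer, obtained by comparing A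
    with A + t (x - A) and letting t tend to 0. *)
Lemma resolvent c S tau : 0 < tau -> dom hs S ->
  exists A r, subdiff dot h A r /\ tau *: (r - S) = c - A.
Proof.
move=> tau0 hS; have [A hA Amin] := prox_minimizer c tau0 hS.
exists A, (S + tau^-1 *: (c - A)); split; last first.
  by rewrite addrAC subrr add0r scalerA divff ?scale1r// gt_eqF.
move=> x; have [hx|] := boolP (h x < +oo)%E; last first.
  by rewrite ltey negbK => /eqP ->; rewrite leey.
rewrite (@dom_finE x hx) (dom_finE hA) -EFinD lee_fin.
apply: (@ler_affine_right _ _ _ ((2 * tau)^-1 * dot (x - A) (x - A))).
move=> t t0 t1; set z := t *: x + (1 - t) *: A.
have hz : (h z <= (t * fine (h x) + (1 - t) * fine (h A))%:E)%E.
  rewrite EFinD !EFinM -(@dom_finE x hx) -(dom_finE hA).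
  by apply: h_convex; rewrite ltW.
have [dz le_z] := epi_dom hz.
have := Amin z dz _ le_z.
have -> : z - c = (A - c) + t *: (x - A).
  rewrite /z scalerBl scale1r scalerBr addrAC !addrA; congr (_ + _).
  by rewrite [RHS]addrC !addrA addrAC.
have -> : dot S z = dot S A + t * dot S (x - A).
  by rewrite /z (dotBr euc) (dotDr euc) !(dotZr euc); ring.
rewrite (dotDl euc (A - c)) !(dotDr euc _ (A - c)) !(dotZl euc) !(dotZr euc).
rewrite (dotC euc (x - A) (A - c)) (dotDl euc S) (dotZl euc).
have -> : dot (c - A) (x - A) = - dot (A - c) (x - A).
  by rewrite -(dotNl euc) opprB.
set d := dot (x - A) _; set e := dot (A - c) (x - A); set f := dot (A - c) (A - c).
set g := dot S (x - A) => H.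
rewrite -subr_ge0 -(pmulr_rge0 _ t0).
move: H; rewrite -subr_ge0; congr (0 <= _); field; lra.
Qed.

(** The point c is a limit of points A carrying a subgradient and such that
    gap(A,S) <= m.  Convergence is expressed through the pairings with
    arbitrary w, in which it is used.  The subgradients at A may be unbounded. *)
Definition near_graph c S m := forall k, 0 < k -> exists A r,
  [/\ subdiff dot h A r, fenchel_gap dot h A S <= m &
      forall w, dot (c - A) w <= k * (m + dot w w)].

(** The approximating points are the proximal points with parameter k^2. *)
Lemma near_graph_resolvent c S m : dom hs S ->
  (forall A r tau, 0 < tau -> subdiff dot h A r -> tau *: (r - S) = c - A ->
     gap A S <= m /\ tau^-1 * dot (c - A) (c - A) <= m) ->
  near_graph c S m.
Proof.
move=> hS H k k0; have kk0 : 0 < k * k by rewrite mulr_gt0.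
have [A [r [hAr rE]]] := resolvent c kk0 hS.
have [mA cA] := H _ _ _ kk0 hAr rE.
exists A, r; split=> // w; apply: le_trans (dot_young euc _ _ k0) _.
have m0 : 0 <= m.
  by apply: le_trans mA; apply: gap_ge0 => //; exact: subdiff_dom hAr.
have cA' : k^-1 * dot (c - A) (c - A) <= k * m.
  by move: cA; rewrite invfM -mulrA ler_pdivrMl.
have w0 := dot_ge0 euc w.
have := mulr_ge0 (ltW k0) m0; have := mulr_ge0 (ltW k0) w0; nra.
Qed.

(** For the proximal pair (A,r) of a with reference S, the four-term identity
    reads gap(a,S) = gap(a,r) + gap(A,S) + |a - A|^2 / tau, with all three
    terms nonnegative. *)
Lemma near_graph_dom a S : dom h a -> dom hs S -> near_graph a S (gap a S).
Proof.
move=> ha hS; apply: near_graph_resolvent => // A r tau tau0 hAr rE.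
have := gap_exchange a S hAr.
have -> : dot (a - A) (S - r) = - (tau^-1 * dot (a - A) (a - A)).
  rewrite -{3}rE (dotZr euc) mulrA mulVf ?gt_eqF// mul1r.
  by rewrite -(dotNr euc) opprB.
have := gap_ge0 ha (subdiff_dom_conj hAr).
have := gap_ge0 (subdiff_dom hAr) hS.
have : 0 <= tau^-1 * dot (a - A) (a - A).
  by rewrite mulr_ge0// ?invr_ge0 ?(ltW tau0)// dot_ge0.
by move=> ? ? ? ?; split; lra.
Qed.

(** * A self-improving Young inequality *)

(** By duality, this says that h grows in a controlled way from b to
    b + (a - b) / theta: the smaller theta, the farther the control reaches. *)
Definition weighted_young (theta M : R) := forall a r b S s,
  subdiff dot h a r -> subdiff dot h b S -> dom hs s ->
  dot (a - b) (s - S) <= theta * gap b s + M * gap a S.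

(** Both sides are continuous in the point, so that the inequality passes to
    limits of points carrying a subgradient. *)
Lemma weighted_young_near theta M c S b m s : 0 <= M -> weighted_young theta M ->
  near_graph c S m -> subdiff dot h b S -> dom hs s ->
  dot (c - b) (s - S) <= theta * gap b s + M * m.
Proof.
move=> M0 st nc hbS hs'.
apply: (@ler_affine_right _ _ _ (m + dot (s - S) (s - S))) => k k0 _.
have [A [r [hAr mA cA]]] := nc _ k0.
rewrite -(subrKA A c) (dotDl euc (c - A)).
have := st _ _ _ _ _ hAr hbS hs'; have := cA (s - S).
have := ler_wpM2l M0 mA; lra.
Qed.

(** Testing the inequality with the subgradient q of a proximal point A of the
    dilated point c makes the terms in A - b cancel, and leaves
    gap(A,S) + |c - A|^2 / tau <= M gap(a,S) / theta for every tau.  Hence c is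
    reached from the graph of the subdifferential, although h could a priori be
    infinite there. *)
Lemma near_graph_weighted_young theta M a r b S : 0 < theta ->
  weighted_young theta M -> subdiff dot h a r -> subdiff dot h b S ->
  near_graph (b + theta^-1 *: (a - b)) S (theta^-1 * (M * gap a S)).
Proof.
move=> t0 st har hbS; set c := b + _.
have acE : theta *: (c - b) = a - b.
  by rewrite /c addrC addKr scalerA divff ?scale1r// gt_eqF.
apply: near_graph_resolvent; first exact: subdiff_dom_conj hbS.
move=> A q tau tau0 hAq qE.
have := st _ _ _ _ _ har hbS (subdiff_dom_conj hAq).
have := gap_exchange A q hbS; rewrite (gap_subdiff hAq) add0r => gE.
rewrite -acE (dotZl euc) -(subrKA A c) (dotDl euc (c - A)).
have -> : dot (c - A) (q - S) = tau^-1 * dot (c - A) (c - A).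
  by rewrite -{3}qE (dotZr euc) mulrA mulVf ?gt_eqF// mul1r.
set e := tau^-1 * _.
have e0 : 0 <= e by rewrite mulr_ge0// ?invr_ge0 ?(ltW tau0)// dot_ge0.
have g0 : 0 <= gap A S.
  by apply: gap_ge0; [exact: subdiff_dom hAq | exact: subdiff_dom_conj hbS].
move=> H; rewrite !ler_pdivlMl//; have te := mulr_ge0 (ltW t0) e0.
have tg := mulr_ge0 (ltW t0) g0.
have gE' : gap b q = dot (A - b) (q - S) - gap A S by lra.
by move: H; rewrite gE' mulrDr mulrBr => H; split; lra.
Qed.

(** Apply the second inequality at the dilated point b + (a - b) / theta
    provided by the first one, and multiply by theta. *)
Lemma weighted_young_comp theta M theta' M' : 0 < theta -> 0 <= M' ->
  weighted_young theta M -> weighted_young theta' M' ->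
  weighted_young (theta * theta') (M * M').
Proof.
move=> t0 M0 st st' a r b S s har hbS hs'.
have := weighted_young_near M0 st' (near_graph_weighted_young t0 st har hbS) hbS hs'.
rewrite [b + _]addrC addrK (dotZl euc) -(ler_pM2l t0) mulrA divff ?gt_eqF//.
rewrite mul1r mulrDr [theta * (theta' * _)]mulrA => /le_trans; apply.
rewrite lerD2l le_eqVlt; apply/orP; left; apply/eqP; field.
exact: lt0r_neq0.
Qed.

Lemma weighted_young_exp theta M k : 0 < theta -> 0 <= M ->
  weighted_young theta M -> weighted_young (theta ^+ k.+1) (M ^+ k.+1).
Proof.
move=> t0 M0 st; elim: k => [|k IH]; first by rewrite !expr1.
by rewrite !(exprS _ k.+1); apply: weighted_young_comp => //; exact: exprn_ge0.
Qed.

(** * Consequences of the Bregman-Young inequality *)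
Context {Ceps : R -> R}.
Hypothesis BY : bregman_young dot Ceps h.

Lemma gap_young eps a1 a2 r1 r2 b S : 0 < eps ->
  dom h a1 -> dom hs r1 -> subdiff dot h a2 r2 -> subdiff dot h b S ->
  `|dot (a1 - a2) (r1 - S)| <=
    eps * (gap a1 r2 + gap a2 r1) + Ceps eps * gap b r1.
Proof.
move=> e0 ha1 hr1 h2 h3; rewrite -lee_fin.
have := BY e0 ha1 (ex_intro _ _ h2) hr1 (ex_intro _ _ (subdiff_conjC h2))
  (ex_intro _ _ (subdiff_conjC h3)) (subdiff_conjC h2) (subdiff_conjC h3).
by rewrite (bregmanE ha1 h2) !bregman_conjE// -EFinD -!EFinM -EFinD abse_EFin.
Qed.

(** Taking a1 = a and r1 = S in the Bregman-Young inequality, its left-hand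
    side becomes the sum gap(a,S) + gap(b,r) of both divergences, while the
    right-hand side contains gap(a,S) only. *)
Lemma gap_quasi_symmetric a r b S :
  subdiff dot h a r -> subdiff dot h b S -> gap b r <= Ceps 1 * gap a S.
Proof.
move=> har hbS.
have := gap_exchange a r hbS; rewrite (gap_subdiff har) add0r.
have := gap_young ltr01 (subdiff_dom har) (subdiff_dom_conj hbS) hbS har.
rewrite (gap_subdiff hbS) addr0 mul1r ler_norml => /andP[+ _].
rewrite -(opprB r S) (dotNr euc); lra.
Qed.

(** Let x be the left-hand side, d = gap(a,S), y = gap(b,s) and C the constant
    for the parameter 1/2.  With third pair (a,r), the Bregman-Young inequality
    bounds x, up to a multiple of d, by (d + y)/2 + C gap(a,s), and
    gap(a,s) = d + y - x.  The large constant C thus multiplies y - x and not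
    y: solving for x gives y the factor (1/2 + C)/(1 + C) < 1. *)
Lemma weighted_young_start : 0 < Ceps 2^-1 ->
  weighted_young ((2^-1 + Ceps 2^-1) / (1 + Ceps 2^-1))
            ((2^-1 + Ceps 2^-1 + Ceps 1 + 1) / (1 + Ceps 2^-1)).
Proof.
set C := Ceps 2^-1 => C0 a r b S s har hbS hs'.
have e0 : 0 < 2^-1 :> R by rewrite invr_gt0.
have := gap_young e0 (subdiff_dom har) hs' hbS har; rewrite -/C.
move=> /(le_trans (ler_norm _)).
have := gap_exchange a s hbS; have := gap_exchange a r hbS; rewrite (gap_subdiff har) add0r.
have := gap_quasi_symmetric har hbS.
have -> : dot (a - b) (s - r) = dot (a - b) (s - S) - dot (a - b) (r - S).
  by rewrite -(dotBr euc) opprB addrA subrK.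
set x := dot (a - b) (s - S); set d := gap a S; set y := gap b s.
have C1 : 0 < 1 + C by rewrite addr_gt0.
move=> q1 q2 q3 q4; rewrite -(ler_pM2l C1).
have -> : (1 + C) * ((2^-1 + C) / (1 + C) * y +
    (2^-1 + C + Ceps 1 + 1) / (1 + C) * d) =
    (2^-1 + C) * y + (2^-1 + C + Ceps 1 + 1) * d by field; exact: lt0r_neq0.
move: q4; have -> : gap a s = d + y - x by lra.
lra.
Qed.

(** * Pointwise estimates *)

(** In this section (a1,r1) is the approximate pair, (a2,r2) the exact pair and
    (b,S) the conforming pair used for comparison. *)
Section dual_estimate.
Variables (M : R) (a1 r1 a2 r2 b S : E).
Hypotheses (M0 : 0 <= M) (st : weighted_young 2^-1 M).
Hypotheses (ha1 : dom h a1) (hr1 : dom hs r1).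
Hypotheses (h2 : subdiff dot h a2 r2) (h3 : subdiff dot h b S).

(** The weighted inequality gives a bound by gap(b,r1)/2, and gap(b,r1) is itself
    the left-hand side plus known gaps, by the four-term identity. *)
Lemma dot_near_le :
  dot (a1 - b) (r1 - S) <= (1 + 2 * M) * gap a1 S + gap a1 r1.
Proof.
have hS := subdiff_dom_conj h3.
have := weighted_young_near M0 st (near_graph_dom ha1 hS) h3 hr1.
have := gap_exchange a1 r1 h3; have := gap_ge0 ha1 hS; lra.
Qed.

(** Here the difference b - a1 has the wrong sign for the inequality based at b.
    It is applied at the base point a1 instead, or rather at a nearby point A with
    a subgradient r: the pairing of b - A with r - S is nonpositive by
    monotonicity, and the one with r2 - r is bounded with the quasi-symmetry of
    the gap. *)
Lemma dot_far_le : 0 <= Ceps 1 ->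
  dot (b - a1) (r2 - S) <= 2^-1 * gap a1 r2 + M * Ceps 1 * gap a1 S.
Proof.
move=> C0; have hS := subdiff_dom_conj h3.
set w := r2 - S.
apply: (@ler_affine_right _ _ _ (2 * (gap a1 S + dot w w))) => k k0 _.
have [A [r [hAr mA cA]]] := near_graph_dom ha1 hS k0.
have H1 := st h3 hAr (subdiff_dom_conj h2).
have H2 : dot (b - A) (r - S) <= 0.
  rewrite -oppr_ge0 -(dotNl euc) opprB.
  have := gap_exchange A r h3; rewrite (gap_subdiff hAr) add0r => <-.
  apply: addr_ge0; apply: gap_ge0 => //.
  + exact: subdiff_dom hAr.
  + exact: subdiff_dom h3.
  + exact: subdiff_dom_conj hAr.
have H3 : gap A r2 <= gap a1 r2 + dot (a1 - A) w.
  move: mA; rewrite /fenchel_gap /w !(dotBl euc) !(dotBr euc).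
  rewrite !(dotC euc a1) !(dotC euc A); lra.
have H4 : dot (b - A) w = dot (b - A) (r2 - r) + dot (b - A) (r - S).
  by rewrite -(dotDr euc) addrA subrK.
have H5 : dot (b - a1) w = dot (b - A) w - dot (a1 - A) w.
  by rewrite -(dotBl euc) opprB addrA subrK.
have H6 : - dot (a1 - A) w <= k * (gap a1 S + dot w w).
  by have := cA (- w); rewrite !(dotNr euc) (dotNl euc) opprK.
have H7 := cA w.
have H8 : M * gap b r <= M * Ceps 1 * gap a1 S.
  rewrite -mulrA ler_wpM2l//.
  apply: le_trans (gap_quasi_symmetric hAr h3) _.
  by rewrite ler_wpM2l.
lra.
Qed.

(** The pairing (a1 - a2).(r1 - r2) is split along b and S; the term
    gap(a1,r2)/2 coming from [dot_far_le] is absorbed on the left. *)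
Lemma primal_estimate : 0 <= Ceps 1 ->
  gap a1 r2 + gap a2 r1 <=
    (4 + 4 * M + 2 * M * Ceps 1) * (gap a1 r1 + gap a1 S)
    + 2 * dot (b - a2) (r1 - r2).
Proof.
move=> C0; have := dot_near_le; have := dot_far_le C0.
have := gap_exchange a1 r1 h2.
have -> : dot (a1 - a2) (r1 - r2) =
    dot (a1 - b) (r1 - S) + dot (b - a1) (r2 - S) + dot (b - a2) (r1 - r2).
  rewrite !(dotBl euc) !(dotBr euc); ring.
have k0 := gap_ge0 ha1 (subdiff_dom_conj h3).
have m0 := gap_ge0 ha1 hr1.
have X0 := gap_ge0 ha1 (subdiff_dom_conj h2).
have Y0 := gap_ge0 (subdiff_dom h2) hr1.
have := mulr_ge0 M0 m0; have := mulr_ge0 (mulr_ge0 M0 C0) m0.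
lra.
Qed.

End dual_estimate.

End convex.

Lemma exists_expr_le (R : realType) (x e : R) : 0 <= x -> x < 1 -> 0 < e ->
  exists k, x ^+ k.+1 <= e.
Proof.
move=> x0 x1 e0.
have /cvgrPdist_le /(_ _ e0)[k _ /(_ k.+1 (leqnSn k))] :
  (x ^+ n @[n --> \oo] --> (0 : R))%classic.
  by apply: cvg_expr; rewrite ger0_norm.
by rewrite /= sub0r normrN ger0_norm ?exprn_ge0// => ?; exists k.
Qed.

Section extended_estimates.
Context {R : realType} {E : normedModType R} {dot : E -> E -> R}.
Context {h : E -> \bar R}.
Hypothesis euc : euclidean dot.
Hypothesis h_proper : proper_fun h.
Local Notation hs := (conj dot h).
Local Open Scope ereal_scope.

(** The density of the estimator; it is infinite as soon as one of the
    arguments is outside the corresponding domain. *)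
Definition efenchel_gap {R : realType} {E : normedModType R} (dot : E -> E -> R)
    (h : E -> \bar R) (a r : E) : \bar R :=
  h a - (dot r a)%:E + conj dot h r.

Lemma efenchel_gapE a r : dom h a -> dom hs r ->
  efenchel_gap dot h a r = (fenchel_gap dot h a r)%:E.
Proof.
move=> ha hr; rewrite /efenchel_gap (dom_finE h_proper ha).
rewrite (dom_conj_finE h_proper hr) -EFinB -EFinD; congr EFin.
by rewrite /fenchel_gap; lra.
Qed.

Lemma efenchel_gapy a r : ~ (dom h a /\ dom hs r) -> efenchel_gap dot h a r = +oo.
Proof.
rewrite /efenchel_gap => nd; have [ha|] := boolP (h a < +oo).
  rewrite (dom_finE h_proper ha) -EFinB.
  suff -> : hs r = +oo by rewrite addey.
  by apply/eqP; rewrite -leye_eq leNgt; apply/negP => hr; apply: nd.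
rewrite ltey negbK => /eqP ->.
by rewrite addye ?(conj_neqNy h_proper).
Qed.

Lemma efenchel_gap_ge0 a r : 0 <= efenchel_gap dot h a r.
Proof.
have [[ha hr]|nd] := pselect (dom h a /\ dom hs r).
  by rewrite efenchel_gapE// lee_fin gap_ge0.
by rewrite efenchel_gapy.
Qed.

Lemma efenchel_gap_eq0 a r : efenchel_gap dot h a r = 0 -> subdiff dot h a r.
Proof.
have [[ha hr]|nd] := pselect (dom h a /\ dom hs r); last by rewrite efenchel_gapy.
by rewrite efenchel_gapE// => -[]; exact: subdiff_gap.
Qed.

Lemma bregman_subdiff_ge0 (g : E -> \bar R) (s a b : E) : proper_fun g ->
  subdiff dot g b s -> 0 <= bregman dot g s a b.
Proof.
move=> gp gbs; have [c gc] := gp.2.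
have gb : g b = (fine (g b))%:E.
  rewrite fineK// fin_numE (gp.1 b) /=; have := gbs c.
  by apply: contraTneq => ->; rewrite addye// -ltNge.
rewrite /bregman gb; have := gbs a; rewrite gb -EFinD.
case: (g a) (gp.1 a) => [x _| _ _|//]; last by rewrite leey.
by rewrite -!EFinB !lee_fin; lra.
Qed.

Lemma bregman_finE (g : E -> \bar R) (s a b : E) : dom g a -> (forall x, g x != -oo) ->
  subdiff dot g b s ->
  bregman dot g s a b = (fine (g a) - fine (g b) - dot s (a - b)%R)%:E.
Proof.
move=> ga gNy gbs; have gaE : g a = (fine (g a))%:E.
  by rewrite fineK// fin_numE gNy /= -ltey.
have gbE : g b = (fine (g b))%:E.
  rewrite fineK// fin_numE gNy /=; have := gbs a; rewrite gaE.
  by apply: contraTneq => ->; rewrite addye// -ltNge ltry.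
by rewrite /bregman gaE gbE.
Qed.

(** Estimates by the extended Fenchel gap need a proof inside the domains only,
    since their right-hand side is infinite elsewhere. *)
Lemma lee_affine_bound (C f : R) (a r : E) (k X : \bar R) : (0 < C)%R -> 0 <= k ->
  (dom h a -> dom hs r -> X <= C%:E * (efenchel_gap dot h a r + k) + f%:E) ->
  X <= C%:E * (efenchel_gap dot h a r + k) + f%:E.
Proof.
move=> C0 k0 H; have [[ha hr]|nd] := pselect (dom h a /\ dom hs r); first exact: H.
rewrite efenchel_gapy// addye ?gt0_muley ?lte_fin ?addye ?leey//.
by rewrite gt_eqF// (lt_le_trans _ k0)// ltNyr.
Qed.

End extended_estimates.

(** The two pointwise estimates behind the theorem.  Summed over the two
    integrands, the trailing pairings become conforming, hence of mean zero:
    in the first one when r1 comes from a conforming field, in the second one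
    when a1 comes from a conforming function. *)
Definition bregman_estimates {R : realType} {E : normedModType R}
    (dot : E -> E -> R) (h : E -> \bar R) (C : R) : Prop :=
  forall a1 r1 a2 r2, subdiff dot h a2 r2 ->
  (forall b s, subdiff dot h b s ->
    (bregman dot h r2 a1 a2 + bregman dot (conj dot h) a2 r1 r2 <=
     C%:E * (efenchel_gap dot h a1 r1 + bregman dot h s a1 b)
     + (2 * dot (b - a2)%R (r1 - r2)%R)%:E)%E) /\
  (forall b s, subdiff dot (conj dot h) s b ->
    (bregman dot h r2 a1 a2 + bregman dot (conj dot h) a2 r1 r2 <=
     C%:E * (efenchel_gap dot h a1 r1 + bregman dot (conj dot h) b r1 s)
     + (2 * dot (a1 - a2)%R (s - r2)%R)%:E)%E).

(** The constant is chosen before the space and the function: it depends on the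
    Bregman-Young constants for the parameters 1/2 and 1 only. *)
Lemma bregman_young_estimates (R : realType) (Ceps : R -> R) :
  (forall eps, 0 < eps -> 0 < Ceps eps) ->
  exists2 C : R, 0 < C &
  forall (E : normedModType R) (dot : E -> E -> R) (h : E -> \bar R),
  euclidean dot -> proper_fun h -> convex_fun h -> closed (epi h) ->
  bregman_young dot Ceps h -> bregman_estimates dot h C.
Proof.
move=> Ceps0.
have C1 := Ceps0 1 ltr01; have C20 : 0 < Ceps 2^-1 by apply: Ceps0; rewrite invr_gt0.
set C2 := Ceps 2^-1 in C20.
set th := (2^-1 + C2) / (1 + C2).
set M0 := (2^-1 + C2 + Ceps 1 + 1) / (1 + C2).
have D0 : 0 < 1 + C2 by rewrite addr_gt0.
have th0 : 0 < th by rewrite divr_gt0// addr_gt0// invr_gt0.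
have th1 : th < 1 by rewrite ltr_pdivrMr// mul1r; lra.
have M00 : 0 <= M0 by rewrite divr_ge0//; lra.
have [k thk] : exists k, th ^+ k.+1 <= 2^-1.
  by apply: exists_expr_le; rewrite ?invr_gt0 ?(ltW th0).
set M := M0 ^+ k.+1; have M_ge0 : 0 <= M by exact: exprn_ge0.
have MC : 0 <= M * Ceps 1 by rewrite mulr_ge0// ltW.
exists (4 + 4 * M + 2 * M * Ceps 1 + 2 * C2); first lra.
move=> E dot h euc hp hc hcl BY a1 r1 a2 r2 h2.
set C := _ + 2 * C2; have C0 : 0 < C by rewrite /C; lra.
split=> b s h3.
  apply: (lee_affine_bound hp) => //; first exact: bregman_subdiff_ge0 h3.
  move=> ha1 hr1; rewrite efenchel_gapE//.
  rewrite !(bregmanE euc hp) // (bregman_conjE euc hp)//.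
  rewrite -!EFinD lee_fin.
  have st : weighted_young (dot := dot) (h := h) 2^-1 M.
    move=> a r b' S s' har hbS hs'.
    have := weighted_young_exp euc hp hc hcl k th0 M00 (weighted_young_start euc hp BY C20)
      har hbS hs'.
    move=> /le_trans; apply; rewrite lerD2r ler_wpM2r//.
    by apply: gap_ge0 => //; exact: subdiff_dom hbS.
  apply: le_trans (primal_estimate euc hp hc hcl BY M_ge0 st ha1 hr1 h2 h3 (ltW C1)) _.
  rewrite lerD2r ler_wpM2r//; last by rewrite /C; lra.
  by rewrite addr_ge0// gap_ge0//; exact: subdiff_dom_conj h3.
have hsp : proper_fun (conj dot h).
  by split; [exact: conj_neqNy | exists r2; exact: subdiff_dom_conj h2].
apply: (lee_affine_bound hp) => //; first exact: bregman_subdiff_ge0 h3.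
move=> ha1 hr1; rewrite efenchel_gapE//.
have e0 : 0 < 2^-1 :> R by rewrite invr_gt0.
have := BY _ e0 _ _ _ _ _ _ ha1 (ex_intro _ _ h2) hr1
  (ex_intro _ _ (subdiff_conjC euc hp h2)) (ex_intro _ _ h3)
  (subdiff_conjC euc hp h2) h3.
have kE := bregman_finE hr1 hsp.1 h3.
have k0 := bregman_subdiff_ge0 r1 hsp h3.
move: kE k0; set K := bregman _ _ b r1 s; set kr := (_ - _ - _)%R => -> .
rewrite lee_fin => kr0.
rewrite !(bregmanE euc hp) // (bregman_conjE euc hp)//.
rewrite -!EFinD abse_EFin !lee_fin -/C2 => /(le_trans (ler_norm _)).
have := gap_exchange euc hp a1 r1 h2.
have -> : dot (a1 - a2) (r1 - r2) = dot (a1 - a2) (r1 - s) + dot (a1 - a2) (s - r2).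
  by rewrite -(dotDr euc) addrA subrK.
have m0 := gap_ge0 hp ha1 hr1.
have X0 := gap_ge0 hp ha1 (subdiff_dom_conj euc hp h2).
have Y0 := gap_ge0 hp (subdiff_dom hp h2) hr1.
have := mulr_ge0 M_ge0 m0; have := mulr_ge0 MC m0; have := mulr_ge0 (ltW C20) m0.
have := mulr_ge0 M_ge0 kr0; have := mulr_ge0 MC kr0.
rewrite /C; lra.
Qed.
(** * The two concrete inner products *)
Lemma vdot_continuous (R : realType) n :
  continuous (fun p : 'rV[R]_n.+1 * 'rV[R]_n.+1 => vdot p.1 p.2).
Proof.
rewrite /vdot; apply: continuous_big => [|i _]; first exact: add_continuous.
move=> p; apply: cvgM.
  by apply: (@continuous_comp _ _ _ fst (fun x : 'rV[R]_n.+1 => x 0 i));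
    [exact: cvg_fst|exact: coord_continuous].
by apply: (@continuous_comp _ _ _ snd (fun x : 'rV[R]_n.+1 => x 0 i));
  [exact: cvg_snd|exact: coord_continuous].
Qed.

Lemma vdot_compact (R : realType) n (M : R) :
  compact [set x : 'rV[R]_n.+1 | vdot x x <= M].
Proof.
apply: bounded_closed_compact; last first.
  apply: (@closed_comp _ _ (fun x : 'rV[R]_n.+1 => vdot x x) [set x | x <= M]);
    last exact: closed_le.
  move=> x _; apply: (@continuous2_cvg _ _ _ _ (nbhs x) _ id id vdot x x);
    [exact: (@vdot_continuous R n (x, x))|exact: cvg_id|exact: cvg_id].
exists (1 + M); split; first exact: num_real.
move=> K MK x /= xM; have xi i : `|x 0 i| <= K.
  have : x 0 i * x 0 i <= M.
    apply: le_trans xM; rewrite /vdot (bigD1 i)//= lerDl.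
    by apply: sumr_ge0 => j _; rewrite -expr2 sqr_ge0.
  by move=> ?; rewrite ler_norml; apply/andP; split; nra.
rewrite [leLHS]/Num.Def.normr /= mx_normrE; apply/bigmax_leP; split.
  exact: le_trans (normr_ge0 (x 0 ord0)) (xi ord0).
by case=> i j _ /=; rewrite ord1.
Qed.

Lemma ball_ratr (R : realType) (x e : R) : 0 < e ->
  exists q : rat, ball x e (ratr q).
Proof.
move=> e0; have /rat_in_itvoo[q /itvP qx] : x < x + e by rewrite ltrDl.
exists q; rewrite /ball /= distrC ltr_distl qx andbT.
by rewrite (@le_lt_trans _ _ x)// ?qx// lerBlDl lerDr ltW.
Qed.

Lemma rV_dense_sequence (R : realType) n : exists c : nat -> 'rV[R]_n.+1,
  forall x (e : R), 0 < e -> exists i, ball x e (c i).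
Proof.
exists (fun i => map_mx ratr (odflt 0 (unpickle i : option 'rV[rat]_n.+1))).
move=> x e e0.
have /choice[q qP] : forall j, exists q : rat, ball (x 0 j) e (ratr q).
  by move=> j; exact: ball_ratr.
exists (pickle (\row_j q j)); rewrite pickleK /=; split=> // i j.
by rewrite ord1 !mxE.
Qed.

Lemma vdot_euclidean (R : realType) n : euclidean (@vdot R n.+1).
Proof.
split.
- by move=> x y; apply: eq_bigr => i _; rewrite mulrC.
- move=> x y z; rewrite -big_split; apply: eq_bigr => i _.
  by rewrite mxE mulrDl.
- by move=> t x y; rewrite mulr_sumr; apply: eq_bigr => i _; rewrite mxE mulrA.
- by move=> x; apply: sumr_ge0 => i _; rewrite -expr2 sqr_ge0.
- exact: vdot_continuous.
- exact: vdot_compact.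
- exact: rV_dense_sequence.
Qed.

Lemma sdot_euclidean (R : realType) : euclidean (@sdot R).
Proof.
split.
- by move=> x y; rewrite /sdot mulrC.
- by move=> x y z; rewrite /sdot mulrDl.
- by move=> t x y; rewrite /sdot mulrA.
- by move=> x; rewrite /sdot -expr2 sqr_ge0.
- by move=> p; apply: cvgM; [exact: cvg_fst|exact: cvg_snd].
- move=> M; apply: (@subclosed_compact _ _ `[- (1 + M), 1 + M]%classic).
  + apply: (@closed_comp _ _ (fun x : R => x * x) [set x | x <= M]);
      last exact: closed_le.
    by move=> x _; apply: cvgM; exact: cvg_id.
  + exact: segment_compact.
  + move=> x /=; rewrite /sdot in_itv /= => xM; apply/andP; nra.
- exists (fun i => ratr (odflt 0 (unpickle i : option rat))).
  move=> x e e0.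
  have [q] := ball_ratr x e0.
  by exists (pickle q); rewrite pickleK.
Qed.
(** * Measurability of composites of normal integrands *)
Lemma exists_half_inv (R : realType) (r : R) : 0 < r ->
  exists k : nat, k.+1%:R^-1 + k.+1%:R^-1 < r.
Proof.
move=> r0; exists (Num.bound (r / 2)^-1).
suff : (Num.bound (r / 2)^-1).+1%:R^-1 < r / 2.
  by set e := _^-1 => He; rewrite [ltRHS]splitr ltrD.
rewrite invf_plt ?posrE ?divr_gt0//.
apply: lt_trans (archi_boundP _) _; last by rewrite ltr_nat.
by rewrite invr_ge0 ltW// divr_gt0.
Qed.

Lemma measurable_fun_le_set d (T : measurableType d) (R : realType) (D : set T)
    (f : T -> \bar R) :
  (forall y : R, measurable (D `&` [set x | (f x <= y%:E)%E])) ->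
  measurable_fun D f.
Proof.
move=> H mD; apply: (measurability _ (ErealGenOInfty.measurableE R)) => //.
move=> _ [_ [y ->] <-].
rewrite [X in measurable X](_ : _ = D `\` (D `&` [set x | (f x <= y%:E)%E])); last first.
  apply/seteqP; split=> x /=; rewrite in_itv /= andbT.
    by move=> [Dx fx]; split=> // -[_]; rewrite leNgt fx.
  by move=> [Dx nx]; split=> //; rewrite ltNge; apply/negP => fx; apply: nx.
by apply: measurableD => //; exact: H.
Qed.

Section integrand.
Context {d} {T : measurableType d} {R : realType} {E : normedModType R}.
Context {dot : E -> E -> R}.
Variables (D : set T) (phi : T -> E -> \bar R).
Hypothesis euc : euclidean dot.
Hypothesis mD : measurable D.
Hypothesis epi_closed : forall x, D x -> closed (epi (phi x)).
Hypothesis epi_measurable : forall O : set (E * R), open O ->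
  measurable [set x | D x /\ epi (phi x) `&` O !=set0].

(** Balls with centres in a dense sequence form a countable base, so this is
    Borel measurability; it avoids putting a sigma-algebra on E. *)
Definition ball_measurable {d} {T : measurableType d} {R : realType}
    {E : normedModType R} (D : set T) (a : T -> E) :=
  forall c e, measurable (D `&` [set x | ball c e (a x)]).

(** The inequality phi(x, a(x)) <= y means that (a(x), y) is in the closed
    epigraph, i.e. that for each k some ball of radius 1/(k+1) around
    a point (c_i, y) contains (a(x), y) and meets the epigraph.  Only countably
    many such balls occur. *)
Lemma measurable_integrand a : ball_measurable D a ->
  measurable_fun D (fun x => phi x (a x)).
Proof.
move=> ma; apply: measurable_fun_le_set => y.
have [c dc] := dense_sequence euc.
pose e (k : nat) : R := k.+1%:R^-1.
have e0 k : 0 < e k by rewrite invr_gt0.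
pose O i k : set (E * R) := ball (c i, y) (e k).
have -> : D `&` [set x | (phi x (a x) <= y%:E)%E] =
  \bigcap_k \bigcup_i ((D `&` [set x | ball (c i) (e k) (a x)]) `&`
    [set x | D x /\ epi (phi x) `&` O i k !=set0]).
  apply/seteqP; split=> x /=.
    move=> [Dx ax] k _; have [i xi] := dc (a x) _ (e0 k).
    exists i => //; split; first by split=> //=; exact: ball_sym.
    split=> //; exists (a x, y); split=> //; split=> /=; first exact: ball_sym.
    exact: ballxx.
  move=> H; have Dx : D x by have [i _ [[]]] := H 0%N Logic.I.
  split=> //; suff : epi (phi x) (a x, y) by [].
  apply: (epi_closed Dx) => B /nbhs_ballP[r /= r0 rB].
  have [k kr] := exists_half_inv r0.
  have [i _ [[_ /= xi] [_ [p [pe [/= p1 p2]]]]]] := H k Logic.I.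
  exists p; split=> //; apply: rB; split=> /=.
    apply: le_ball (ltW kr) _ _; apply: ball_triangle p1; exact: ball_sym.
  apply: le_ball p2; apply: ltW; apply: le_lt_trans kr.
  by rewrite lerDl ltW.
apply: bigcapT_measurable => k; apply: bigcupT_measurable => i.
apply: measurableI; first exact: ma.
by apply: epi_measurable; exact: ball_open.
Qed.

(** The conjugate exceeds y at r(x) when the epigraph meets the open set
    of all p with r(x).p1 - p2 > y.  This set depends on x; it is exhausted by
    countably many open sets O i k valid for all w in a ball containing
    r(x). *)
Lemma measurable_conj_integrand r : ball_measurable D r ->
  (forall x, D x -> proper_fun (phi x)) ->
  measurable_fun D (fun x => conj dot (phi x) (r x)).
Proof.
move=> mr hp; apply: measurable_fun_le_set => y.
have [c dc] := dense_sequence euc.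
pose e (k : nat) : R := k.+1%:R^-1.
have e0 k : 0 < e k by rewrite invr_gt0.
pose O i k : set (E * R) :=
  interior [set p | forall w, ball (c i) (e k) w -> y < dot w p.1 - p.2].
pose B := \bigcup_i \bigcup_k ((D `&` [set x | ball (c i) (e k) (r x)]) `&`
    [set x | D x /\ epi (phi x) `&` O i k !=set0]).
have mB : measurable B.
  apply: bigcupT_measurable => i; apply: bigcupT_measurable => k.
  apply: measurableI; first exact: mr.
  by apply: epi_measurable; exact: open_interior.
suff -> : D `&` [set x | (conj dot (phi x) (r x) <= y%:E)%E] = D `\` B.
  exact: measurableD.
apply/seteqP; split=> x /=.
  move=> [Dx cx]; split=> // -[i _ [k _ [[_ /= ri] [_ [p [pe /interior_subset /= pO]]]]]].
  have := pO _ ri; rewrite ltNge => /negP; apply.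
  have [p1 p2] := epi_dom (hp _ Dx) pe.
  have := le_trans (conj_geB p.1 (r x)) cx; rewrite (dom_finE (hp _ Dx) p1).
  by rewrite -EFinB lee_fin => ?; lra.
move=> [Dx nB]; split=> //; apply: ge_ereal_sup => _ [b _ <-].
have [pb|] := boolP (phi x b < +oo)%E; last first.
  by rewrite ltey negbK => /eqP ->; rewrite addeNy leNye.
rewrite (dom_finE (hp _ Dx) pb) -EFinB lee_fin leNgt; apply/negP => yb.
apply: nB.
set z := fine (phi x b) in yb.
pose g (q : E * (E * R)) := dot q.1 q.2.1 - q.2.2.
have cg : continuous g.
  move=> q; apply: cvgB; last first.
    by apply: (@continuous_comp _ _ _ snd snd); exact: cvg_snd.
  apply: (@continuous_comp _ _ _ (fun q : E * (E * R) => (q.1, q.2.1))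
    (fun p : E * E => dot p.1 p.2)); last exact: (dot_continuous euc).
  apply: cvg_pair => //=; first exact: cvg_fst.
  by apply: (@continuous_comp _ _ _ snd fst); [exact: cvg_snd|exact: cvg_fst].
(* joint continuity in (r(x), p) gives a neighbourhood of r(x) that is uniform
   in p *)
have : nbhs (r x, (b, z)) [set q | y < g q].
  apply: (cg (r x, (b, z)) [set t | y < t]).
  by apply: open_nbhs_nbhs; split; [exact: open_gt|].
move=> [[U V] /= [nU nV] UV].
have /nbhs_ballP[s /= s0 sU] := nU.
have [k kr] := exists_half_inv s0.
have [i xi] := dc (r x) _ (e0 k).
exists i => //; exists k => //; split; first by split=> //=; exact: ball_sym.
split=> //; exists (b, z); split; first exact: (dom_epi (hp _ Dx) pb).
apply: filterS nV => p Vp w wi; apply: (UV (w, p)); split=> //=.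
by apply: sU; apply: le_ball (ltW kr) _ _; exact: ball_triangle xi wi.
Qed.

End integrand.

(** * Integrals of functions that are nonnegative almost everywhere *)

Section integral_estimates.
Context d (T : measurableType d) (R : realType) (mu : {measure set T -> \bar R}).
Variable D : set T.
Hypothesis mD : measurable D.
Local Open Scope ereal_scope.
Implicit Types f g : T -> \bar R.

Lemma ae_ge0_funepos f : {ae mu, forall x, D x -> 0 <= f x} ->
  ae_eq mu D f f^\+.
Proof.
by apply: filterS => x fx Dx; rewrite funeposE max_l// fx.
Qed.

Lemma ae_ge0_integralE f : measurable_fun D f ->
  {ae mu, forall x, D x -> 0 <= f x} ->
  \int[mu]_(x in D) f x = \int[mu]_(x in D) f^\+ x.
Proof.
move=> mf f0; apply: ae_eq_integral => //; first exact: measurable_funepos.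
exact: ae_ge0_funepos.
Qed.

Lemma ae_ge0_integral_ge0 f : measurable_fun D f ->
  {ae mu, forall x, D x -> 0 <= f x} -> 0 <= \int[mu]_(x in D) f x.
Proof. by move=> mf f0; rewrite ae_ge0_integralE// integral_ge0. Qed.

Lemma ae_ge0_integralD f g : measurable_fun D f -> measurable_fun D g ->
  {ae mu, forall x, D x -> 0 <= f x} -> {ae mu, forall x, D x -> 0 <= g x} ->
  \int[mu]_(x in D) (f x + g x) = \int[mu]_(x in D) f x + \int[mu]_(x in D) g x.
Proof.
move=> mf mg f0 g0; rewrite (ae_ge0_integralE mf)// (ae_ge0_integralE mg)//.
rewrite -ge0_integralD//; try exact: measurable_funepos.
apply: ae_eq_integral => //; first exact: emeasurable_funD.
  by apply: emeasurable_funD; exact: measurable_funepos.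
move: (ae_ge0_funepos f0) (ae_ge0_funepos g0).
by apply: filterS2 => x fx gx Dx; rewrite -fx// -gx.
Qed.

Lemma ae_ge0_integralZl f (c : R) : measurable_fun D f -> (0 <= c)%R ->
  {ae mu, forall x, D x -> 0 <= f x} ->
  \int[mu]_(x in D) (c%:E * f x) = c%:E * \int[mu]_(x in D) f x.
Proof.
move=> mf c0 f0; rewrite (ae_ge0_integralE mf)//.
rewrite -ge0_integralZl//; last exact: measurable_funepos.
apply: ae_eq_integral => //; first exact: measurable_funeM.
  by apply: measurable_funeM; exact: measurable_funepos.
by apply: filterS (ae_ge0_funepos f0) => x fx Dx; rewrite -fx.
Qed.

Definition null_mean {d} {T : measurableType d} {R : realType}
    (mu : set T -> \bar R) (D : set T) (f : T -> R) : Prop :=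
  mu.-integrable D (EFin \o f) /\ \int[mu]_(x in D) (f x)%:E = 0.

Lemma null_meanB (f g : T -> R) : null_mean mu D f -> null_mean mu D g ->
  null_mean mu D (fun x => f x - g x)%R.
Proof.
move=> [intf f0] [intg g0]; split; first exact: (integrableB mD intf intg).
under eq_integral do rewrite EFinB.
by rewrite (integralB mD intf intg) f0 g0 sube0.
Qed.

Lemma null_meanZ (c : R) (f : T -> R) : null_mean mu D f ->
  null_mean mu D (fun x => c * f x)%R.
Proof.
move=> [intf f0]; split; first exact: (integrableZl mD c intf).
under eq_integral do rewrite EFinM.
by rewrite (integralZl mD intf) f0 mule0.
Qed.

(** The correction f may change sign, so its negative part is first moved to the
    left; its positive and negative parts have the same finite integral. *)
Lemma ae_le_integral_null_mean (rho g : T -> \bar R) (f : T -> R) :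
  measurable_fun D rho -> measurable_fun D g -> null_mean mu D f ->
  {ae mu, forall x, D x -> 0 <= rho x} -> {ae mu, forall x, D x -> 0 <= g x} ->
  {ae mu, forall x, D x -> rho x <= g x + (f x)%:E} ->
  \int[mu]_(x in D) rho x <= \int[mu]_(x in D) g x.
Proof.
move=> mrho mg [intf f0] rho0 g0 le.
have mf := measurable_int _ intf.
have ifn := integrable_neg_fin_num mD intf.
have fpn : \int[mu]_(x in D) (EFin \o f)^\+ x = \int[mu]_(x in D) (EFin \o f)^\- x.
  move: f0; rewrite integralE -(fineK ifn).
  rewrite -(fineK (integrable_pos_fin_num mD intf)) -EFinB => -[/eqP].
  by rewrite subr_eq0 => /eqP ->.
rewrite -(leeD2rE _ _ ifn) -{2}fpn.
rewrite (ae_ge0_integralE mrho)// (ae_ge0_integralE mg)//.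
rewrite -!ge0_integralD//; try exact: measurable_funepos; try exact: measurable_funeneg.
apply: ae_ge0_le_integral => //.
- by move=> x _; rewrite adde_ge0.
- by apply: emeasurable_funD; [exact: measurable_funepos|exact: measurable_funeneg].
- by move=> x _; rewrite adde_ge0.
- by apply: emeasurable_funD; exact: measurable_funepos.
move: (ae_ge0_funepos rho0) (ae_ge0_funepos g0) => rp gp.
apply: filterS3 rp gp le => x rx gx lx Dx; rewrite -rx// -gx//.
have fE : (EFin \o f)^\+ x - (EFin \o f)^\- x = (f x)%:E.
  by rewrite -[RHS]/((EFin \o f) x) [in RHS](funeposneg (EFin \o f)).
have fN : (EFin \o f)^\- x \is a fin_num.
  by rewrite funenegE /= /Order.max; case: ifP.
by rewrite -leeBrDr// -addeA fE lx.
Qed.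

Lemma lee_pmul_ereal_inf (C : R) (X Y : \bar R) (S : set (\bar R)) :
  (0 < C)%R -> 0 <= Y -> (forall B, S B -> 0 <= B) ->
  (forall B, S B -> X <= C%:E * (Y + B)) ->
  X <= C%:E * (Y + ereal_inf S).
Proof.
move=> C0 Y0 S0 XS.
have inf0 : 0 <= ereal_inf S by apply: le_ereal_inf_tmp.
rewrite -lee_pdivrMl//.
have [Yfin|] := boolP (Y \is a fin_num).
  rewrite -leeBlDl//; apply: le_ereal_inf_tmp => B SB.
  by rewrite leeBlDl// lee_pdivrMl// XS.
rewrite ge0_fin_numE// ltey negbK => /eqP ->.
by rewrite addye ?leey// gt_eqF// (lt_le_trans _ inf0)// ltNyr.
Qed.

End integral_estimates.

(** Almost everywhere statements for [leb] range over a type that is only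
    convertible to the type of vectors; these forms apply to them up to
    conversion. *)
Section ae.
Context d (T : measurableType d) (R : realType) (mu : {measure set T -> \bar R}).
Implicit Types P Q S U : T -> Prop.

Lemma ae_mono P Q : (forall x, P x -> Q x) ->
  {ae mu, forall x, P x} -> {ae mu, forall x, Q x}.
Proof. exact: filterS. Qed.

Lemma ae_and P Q : {ae mu, forall x, P x} -> {ae mu, forall x, Q x} ->
  {ae mu, forall x, P x /\ Q x}.
Proof. exact: filterI. Qed.

Lemma ae_all P : (forall x, P x) -> {ae mu, forall x, P x}.
Proof. exact: filterE. Qed.

End ae.

Lemma dual_adde_fin_num (R : realDomainType) (x y : \bar R) :
  ((x + y)%dE \is a fin_num) ->
  [/\ x \is a fin_num, y \is a fin_num & (x + y)%dE = (x + y)%E].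
Proof. by case: x => [x| |]; case: y => [y| |]. Qed.

(** * Lebesgue measurability of the functions of the problem *)

Section fields.
Context (R : realType) (n : nat) (Omega : set 'rV[R]_n.+1).
Local Notation space := 'rV[R]_n.+1.
Local Notation measurable_scalar f :=
  (measurable_fun (Omega : set (leb_type R n)) (f : leb_type R n -> R)).
Hypothesis mO : measurable (Omega : set (leb_type R n)).

Lemma leb_complete : measure_is_complete (@leb R n).
Proof. exact: measure_is_complete_caratheodory. Qed.

Lemma measurable_scalar_ball (f : space -> R) : measurable_scalar f ->
  ball_measurable (Omega : set (leb_type R n)) f.
Proof.
move=> mf c e; apply: mf => //.
by apply: open_measurable; exact: ball_open.
Qed.

Lemma measurable_vec_ball (r : space -> space) : measurable_vec Omega r ->
  ball_measurable (Omega : set (leb_type R n)) r.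
Proof.
move=> mr c e; have [e0|e0] := ltP 0 e; last first.
  rewrite [X in measurable X](_ : _ = set0)//.
  by apply/seteqP; split=> // x [_ [/= ]]; rewrite ltNge e0.
rewrite [X in measurable X](_ : _ = \bigcap_(k : nat)
    (Omega `&` [set x | ball (c 0 (inord k)) e (r x 0 (inord k))])).
  by apply: bigcapT_measurable => k; exact: measurable_scalar_ball (mr _) _ _.
apply/seteqP; split=> x /=.
  by move=> [Ox [_ xr]] k _; split=> //=; exact: xr.
move=> H; have [Ox _] := H 0%N Logic.I; split=> //; split=> // i j.
by rewrite !ord1; have [_ /=] := H j Logic.I; rewrite inord_val.
Qed.

Lemma measurable_vdot (r a : space -> space) :
  measurable_vec Omega r -> measurable_vec Omega a ->
  measurable_scalar (fun x => vdot (r x) (a x)).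
Proof.
move=> mr ma; apply: measurable_sum => i; exact: measurable_funM (mr i) (ma i).
Qed.

Lemma measurable_vecB (r a : space -> space) :
  measurable_vec Omega r -> measurable_vec Omega a ->
  measurable_vec Omega (fun x => r x - a x).
Proof.
move=> mr ma i.
rewrite [X in measurable_fun _ X](_ : _ = fun x => r x 0 i - a x 0 i).
  exact: measurable_funB (mr i) (ma i).
by apply/funext => x; rewrite !mxE.
Qed.

Lemma ae_measurable_scalar (f g : space -> R) : measurable_scalar f ->
  {ae leb, forall x, Omega x -> f x = g x} -> measurable_scalar g.
Proof.
move=> /measurable_EFinP mf fg; apply/measurable_EFinP.
apply: (ae_measurable_fun leb_complete _ mf).
by apply: ae_mono fg => x fg Ox /=; rewrite fg.
Qed.

Lemma ae_measurable_vec (r a : space -> space) : measurable_vec Omega r ->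
  {ae leb, forall x, Omega x -> r x = a x} -> measurable_vec Omega a.
Proof.
move=> mr ra i; apply: (ae_measurable_scalar (mr i)).
by apply: ae_mono ra => x ra Ox; rewrite ra.
Qed.

Lemma W1_measurable p v : W1 p Omega v ->
  measurable_scalar v /\ measurable_vec Omega (grad Omega v).
Proof.
by move=> [[mv _] _ mg]; split=> // i; have [] := mg i.
Qed.

Lemma Wdiv_measurable r : Wdiv Omega r ->
  measurable_vec Omega r /\ measurable_scalar (div Omega r).
Proof.
move=> /(xgetPex (fun=> 0)) [mr [md _] _]; split=> // i.
by have [] := mr i.
Qed.

Section bregman_measurability.
Context {E : normedModType R} {dot : E -> E -> R}.
Variable phi : space -> E -> \bar R.
Hypothesis euc : euclidean dot.
Hypothesis hphi : normal_convex_integrand Omega phi.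
Local Notation ball_meas := (ball_measurable (Omega : set (leb_type R n))).
Local Notation emeas f :=
  (measurable_fun (Omega : set (leb_type R n)) (f : leb_type R n -> \bar R)).

Lemma normal_proper x : Omega x -> proper_fun (phi x).
Proof. by move=> /hphi.1[]. Qed.

Lemma emeasurable_normal (a : space -> E) : ball_meas a ->
  emeas (fun x => phi x (a x)).
Proof.
move=> ma; have cl x : Omega x -> closed (epi (phi x)) by move=> /hphi.1[].
exact: (@measurable_integrand _ (leb_type R n) _ _ _ _ _ euc cl hphi.2 _ ma).
Qed.

Lemma emeasurable_conj (r : space -> E) : ball_meas r ->
  emeas (fun x => conj dot (phi x) (r x)).
Proof.
move=> mr.
exact: (@measurable_conj_integrand _ (leb_type R n) _ _ _ _ _ euc mO hphi.2 _ mr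
  normal_proper).
Qed.

Lemma emeasurable_bregman (g a b : space -> E) : ball_meas a -> ball_meas b ->
  measurable_scalar (fun x => dot (g x) (a x - b x)) ->
  emeas (fun x => bregman dot (phi x) (g x) (a x) (b x)).
Proof.
move=> ma mb mg; apply: emeasurable_funB; last exact/measurable_EFinP.
by apply: emeasurable_funB; exact: emeasurable_normal.
Qed.

Lemma emeasurable_bregman_conj (g a b : space -> E) : ball_meas a -> ball_meas b ->
  measurable_scalar (fun x => dot (g x) (a x - b x)) ->
  emeas (fun x => bregman dot (conj dot (phi x)) (g x) (a x) (b x)).
Proof.
move=> ma mb mg; apply: emeasurable_funB; last exact/measurable_EFinP.
by apply: emeasurable_funB; exact: emeasurable_conj.
Qed.

Lemma emeasurable_efenchel_gap (a r : space -> E) : ball_meas a -> ball_meas r ->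
  measurable_scalar (fun x => dot (r x) (a x)) ->
  emeas (fun x => efenchel_gap dot (phi x) (a x) (r x)).
Proof.
move=> ma mr mg; apply: emeasurable_funD; last exact: emeasurable_conj.
apply: emeasurable_funB; last exact/measurable_EFinP.
exact: emeasurable_normal.
Qed.

End bregman_measurability.

(** In dual addition an infinite positive part cannot be compensated, so a finite
    upper integral forces both parts to be finite. *)
Lemma upper_integral_fin_num (f : space -> \bar R) :
  measurable_fun (Omega : set (leb_type R n)) (f : leb_type R n -> \bar R) ->
  upper_integral Omega f \is a fin_num ->
  leb.-integrable Omega f /\
  upper_integral Omega f = (\int[leb]_(x in Omega) f x)%E.
Proof.
move=> mf /dual_adde_fin_num[fp fn fE]; split; last first.
  by rewrite /upper_integral fE [RHS]integralE.
apply/integrableP; split=> //.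
rewrite fin_numN in fn.
have -> : (fun x => `|f x|)%E = (fun x => f^\+ x + f^\- x)%E.
  by rewrite -/(abse \o f) fune_abse.
rewrite ge0_integralD//; [|exact: measurable_funepos|exact: measurable_funeneg].
by rewrite lte_add_pinfty// ltey_eq ?fp ?fn.
Qed.

End fields.

(** * Optimality relations *)

Lemma ae_ge0_sum_eq0 d (T : measurableType d) (R : realType)
    (mu : {measure set T -> \bar R}) (D : set T) (f g : T -> \bar R) :
  measurable D -> measurable_fun D f -> measurable_fun D g ->
  (forall x, D x -> (0 <= f x)%E) -> (forall x, D x -> (0 <= g x)%E) ->
  (\int[mu]_(x in D) (f x + g x) = 0)%E ->
  {ae mu, forall x, D x -> f x = 0%E /\ g x = 0%E}.
Proof.
move=> mD mf mg f0 g0 int0.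
have mfg := emeasurable_funD mf mg.
have := (ae_eq_integral_abs mu mD mfg).1.
under eq_integral => x /[!inE] Dx do rewrite gee0_abs ?adde_ge0 ?f0 ?g0//.
move=> /(_ int0); apply: ae_mono => x fg0 Dx.
have /eqP := fg0 Dx; rewrite /= padde_eq0 ?f0 ?g0// => /andP[/eqP -> /eqP ->//].
Qed.

(** Addition of extended reals is associative and commutative and the subtracted
    terms are real, so the terms can be regrouped even at infinite values. *)
Lemma addeB_parts (R : realDomainType) (p q s t : \bar R) (a b : R) :
  (p - a%:E + q + (s - b%:E + t) = p + s + (q + t) - (a + b)%:E)%E.
Proof.
case: p => [p| |]; case: q => [q| |]; case: s => [s| |]; case: t => [t| |] //.
by congr EFin; ring.
Qed.

Section problem.
Context (R : realType) (n : nat) (Omega GammaD : set 'rV[R]_n.+1).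
Local Notation space := 'rV[R]_n.+1.
Context (phi : space -> space -> \bar R) (psi : space -> R -> \bar R).
Context (u : space -> R) (q : space -> space).
Hypothesis hphi : normal_convex_integrand Omega phi.
Hypothesis hpsi : normal_convex_integrand Omega psi.

(** The points of the domain are those where the epigraph meets the whole
    space, as the integrand is proper. *)
Lemma measurable_domain : measurable (Omega : set (leb_type R n)).
Proof.
have := hphi.2 setT openT.
rewrite (_ : [set x | _ /\ _] = Omega)//.
apply/seteqP; split=> x /=; first by case.
move=> Ox; split=> //; have [a ha] := (normal_proper hphi Ox).2.
by exists (a, fine (phi x a)); split=> //; exact: (dom_epi (normal_proper hphi Ox) ha).
Qed.
Let mO := measurable_domain.

(** Equality of the finite primal and dual values, together with the
    integration by parts formula for (u,q), says that the Fenchel gaps of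
    (grad u, q) and of (u, div q) have total integral 0.  Being nonnegative,
    they vanish almost everywhere, which is equality in Fenchel's inequality. *)
Lemma strong_duality_subdiff : strong_duality Omega GammaD phi psi u q ->
  parts_relation Omega u q ->
  {ae leb, forall x, Omega x -> subdiff vdot (phi x) (grad Omega u x) (q x)} /\
  {ae leb, forall x, Omega x -> subdiff sdot (psi x) (u x) (div Omega q x)}.
Proof.
move=> [[[W1u _] [Wq _]] [_ Pfin] [_ Dfin] PD] [int_uq uq0].
have [mu mgu] := W1_measurable W1u; have [mq mdq] := Wdiv_measurable Wq.
have ev := vdot_euclidean R n; have es := sdot_euclidean R.
have bu := measurable_scalar_ball mO mu.
have bgu := measurable_vec_ball mO mgu.
have bq := measurable_vec_ball mO mq.
have bdq := measurable_scalar_ball mO mdq.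
have m1 := emeasurable_normal ev hphi bgu.
have m2 := emeasurable_normal es hpsi bu.
have m3 := emeasurable_conj mO ev hphi bq.
have m4 := emeasurable_conj mO es hpsi bdq.
have Pf : primal Omega phi psi u \is a fin_num.
  by rewrite fin_numE -ltey Pfin PD -ltNye Dfin.
have Df : dual Omega phi psi q \is a fin_num by rewrite -PD.
have [U1 U2 PE] := dual_adde_fin_num Pf.
move: Df; rewrite /dual fin_numN => Df.
have [U3 U4 DE] := dual_adde_fin_num Df.
have [i1 E1] := upper_integral_fin_num mO m1 U1.
have [i2 E2] := upper_integral_fin_num mO m2 U2.
have [i3 E3] := upper_integral_fin_num mO m3 U3.
have [i4 E4] := upper_integral_fin_num mO m4 U4.
have mY1 := emeasurable_efenchel_gap mO ev hphi bgu bq (measurable_vdot mq mgu).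
have mY2 := emeasurable_efenchel_gap mO es hpsi bu bdq (measurable_funM mdq mu).
have i12 := integrableD mO i1 i2; have i34 := integrableD mO i3 i4.
have : (\int[leb]_(x in Omega)
    (efenchel_gap vdot (phi x) (grad Omega u x) (q x) +
     efenchel_gap sdot (psi x) (u x) (div Omega q x)) = 0)%E.
  under eq_integral => x _.
    rewrite /efenchel_gap addeB_parts (_ : sdot _ _ = u x * div Omega q x); last first.
      by rewrite /sdot mulrC.
    over.
  rewrite (integralB mO (integrableD mO i12 i34) int_uq) uq0 sube0.
  rewrite (integralD mO i12 i34) (integralD mO i1 i2) (integralD mO i3 i4).
  rewrite -E1 -E2 -E3 -E4 -DE -PE -/(primal Omega phi psi u) PD /dual.
  by rewrite addeC subee.
move=> /(ae_ge0_sum_eq0 mO mY1 mY2 _ _) Y0.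
have {}Y0 := Y0 (fun x Ox => efenchel_gap_ge0 (normal_proper hphi Ox) _ _)
   (fun x Ox => efenchel_gap_ge0 (normal_proper hpsi Ox) _ _).
split.
  apply: ae_mono Y0 => x Y0 Ox; have [Y1 _] := Y0 Ox.
  exact: (efenchel_gap_eq0 _ (normal_proper hphi Ox) Y1).
apply: ae_mono Y0 => x Y0 Ox; have [_ Y2] := Y0 Ox.
exact: (efenchel_gap_eq0 _ (normal_proper hpsi Ox) Y2).
Qed.

Local Notation emeas f :=
  (measurable_fun (Omega : set (leb_type R n)) (f : leb_type R n -> \bar R)).

(** * Integrated estimates *)

Section error_estimate.
Hypothesis u_meas :
  measurable_fun (Omega : set (leb_type R n)) (u : leb_type R n -> R) /\
  measurable_vec Omega (grad Omega u).
Hypothesis q_meas : measurable_vec Omega q /\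
  measurable_fun (Omega : set (leb_type R n)) (div Omega q : leb_type R n -> R).
Hypothesis sub_phi :
  {ae leb, forall x, Omega x -> subdiff vdot (phi x) (grad Omega u x) (q x)}.
Hypothesis sub_psi :
  {ae leb, forall x, Omega x -> subdiff sdot (psi x) (u x) (div Omega q x)}.

(** Common part of both estimates: K1 and K2 are the divergences to the conforming
    competitor, and f1, f2 the pairings left over by the pointwise estimates.
    Only the sum of f1 and f2 has mean zero. *)
Lemma error_estimate (C : R) (a r : space -> space) (v w : space -> R)
    (K1 K2 : space -> \bar R) (f1 f2 f : space -> R) :
  0 < C -> measurable_vec Omega a -> measurable_vec Omega r ->
  measurable_fun (Omega : set (leb_type R n)) (v : leb_type R n -> R) ->
  measurable_fun (Omega : set (leb_type R n)) (w : leb_type R n -> R) ->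
  emeas K1 -> emeas K2 ->
  {ae leb, forall x, Omega x -> (0 <= K1 x)%E} ->
  {ae leb, forall x, Omega x -> (0 <= K2 x)%E} ->
  null_mean leb Omega f ->
  {ae leb, forall x, Omega x -> f1 x + f2 x = f x} ->
  {ae leb, forall x, Omega x ->
    (bregman vdot (phi x) (q x) (a x) (grad Omega u x) +
     bregman vdot (conj vdot (phi x)) (grad Omega u x) (r x) (q x) <=
     C%:E * (efenchel_gap vdot (phi x) (a x) (r x) + K1 x) + (f1 x)%:E)%E} ->
  {ae leb, forall x, Omega x ->
    (bregman sdot (psi x) (div Omega q x) (v x) (u x) +
     bregman sdot (conj sdot (psi x)) (u x) (w x) (div Omega q x) <=
     C%:E * (efenchel_gap sdot (psi x) (v x) (w x) + K2 x) + (f2 x)%:E)%E} ->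
  (\int[leb]_(x in Omega)
    (bregman vdot (phi x) (q x) (a x) (grad Omega u x)
     + bregman sdot (psi x) (div Omega q x) (v x) (u x)
     + bregman vdot (conj vdot (phi x)) (grad Omega u x) (r x) (q x)
     + bregman sdot (conj sdot (psi x)) (u x) (w x) (div Omega q x)) <=
   C%:E * (\int[leb]_(x in Omega) efenchel_gap vdot (phi x) (a x) (r x) +
           \int[leb]_(x in Omega) efenchel_gap sdot (psi x) (v x) (w x) +
           (\int[leb]_(x in Omega) K1 x + \int[leb]_(x in Omega) K2 x)))%E.
Proof.
move=> C0 ma mr mv mw mK1 mK2 K1_ge0 K2_ge0 f_null fE le_phi le_psi.
have [mu mgu] := u_meas; have [mq mdq] := q_meas.
have ev := vdot_euclidean R n; have es := sdot_euclidean R.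
have bu := measurable_scalar_ball mO mu.
have bgu := measurable_vec_ball mO mgu.
have bq := measurable_vec_ball mO mq.
have bdq := measurable_scalar_ball mO mdq.
have ba := measurable_vec_ball mO ma.
have br := measurable_vec_ball mO mr.
have bv := measurable_scalar_ball mO mv.
have bw := measurable_scalar_ball mO mw.
have mY1 := emeasurable_efenchel_gap mO ev hphi ba br (measurable_vdot mr ma).
have mY2 := emeasurable_efenchel_gap mO es hpsi bv bw (measurable_funM mw mv).
have Y1_ge0 : {ae leb, forall x, Omega x ->
    (0 <= efenchel_gap vdot (phi x) (a x) (r x))%E}.
  by apply: ae_all => x Ox; exact: efenchel_gap_ge0 (normal_proper hphi Ox) _ _.
have Y2_ge0 : {ae leb, forall x, Omega x ->
    (0 <= efenchel_gap sdot (psi x) (v x) (w x))%E}.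
  by apply: ae_all => x Ox; exact: efenchel_gap_ge0 (normal_proper hpsi Ox) _ _.
have mA := emeasurable_bregman ev hphi ba bgu
  (measurable_vdot mq (measurable_vecB ma mgu)).
have mB := emeasurable_bregman es hpsi bv bu
  (measurable_funM mdq (measurable_funB mv mu)).
have mA' := emeasurable_bregman_conj mO ev hphi br bq
  (measurable_vdot mgu (measurable_vecB mr mq)).
have mB' := emeasurable_bregman_conj mO es hpsi bw bdq
  (measurable_funM mu (measurable_funB mw mdq)).
have Y_ge0 := ae_and Y1_ge0 Y2_ge0; have K_ge0 := ae_and K1_ge0 K2_ge0.
have mY := emeasurable_funD mY1 mY2; have mK := emeasurable_funD mK1 mK2.
have Ysum_ge0 : {ae leb, forall x, Omega x ->
    (0 <= efenchel_gap vdot (phi x) (a x) (r x) +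
          efenchel_gap sdot (psi x) (v x) (w x))%E}.
  by apply: ae_mono Y_ge0 => x [Y1 Y2] Ox; rewrite adde_ge0 ?Y1 ?Y2.
have Ksum_ge0 : {ae leb, forall x, Omega x -> (0 <= K1 x + K2 x)%E}.
  by apply: ae_mono K_ge0 => x [k1 k2] Ox; rewrite adde_ge0 ?k1 ?k2.
have G_ge0 : {ae leb, forall x, Omega x ->
    (0 <= efenchel_gap vdot (phi x) (a x) (r x) +
          efenchel_gap sdot (psi x) (v x) (w x) + (K1 x + K2 x))%E}.
  by apply: ae_mono (ae_and Ysum_ge0 Ksum_ge0) => x [k1 k2] Ox;
    rewrite adde_ge0 ?k1 ?k2.
have mG := emeasurable_funD mY mK.
rewrite -(ae_ge0_integralD mO mY1 mY2 Y1_ge0 Y2_ge0).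
rewrite -(ae_ge0_integralD mO mK1 mK2 K1_ge0 K2_ge0).
rewrite -(ae_ge0_integralD mO mY mK Ysum_ge0 Ksum_ge0).
rewrite -(ae_ge0_integralZl mO mG (ltW C0) G_ge0).
apply: (ae_le_integral_null_mean mO _ _ f_null).
- exact: (emeasurable_funD (emeasurable_funD (emeasurable_funD mA mB) mA') mB').
- exact: (measurable_funeM _ mG).
- apply: ae_mono (ae_and sub_phi sub_psi) => x [s1 s2] Ox.
  have {}s1 := s1 Ox; have {}s2 := s2 Ox.
  have p1 := normal_proper hphi Ox; have p2 := normal_proper hpsi Ox.
  have c1 : proper_fun (conj vdot (phi x)).
    by split; [exact: (conj_neqNy p1)|exists (q x); exact: (subdiff_dom_conj (vdot_euclidean R n) p1 s1)].
  have c2 : proper_fun (conj sdot (psi x)).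
    by split; [exact: (conj_neqNy p2)|exists (div Omega q x); exact: (subdiff_dom_conj (sdot_euclidean R) p2 s2)].
  apply: adde_ge0; first (apply: adde_ge0; first apply: adde_ge0).
  + exact: bregman_subdiff_ge0 p1 s1.
  + exact: bregman_subdiff_ge0 p2 s2.
  + exact: bregman_subdiff_ge0 c1 (subdiff_conjC (vdot_euclidean R n) p1 s1).
  + exact: bregman_subdiff_ge0 c2 (subdiff_conjC (sdot_euclidean R) p2 s2).
- by apply: ae_mono G_ge0 => x G0 Ox; rewrite mule_ge0 ?G0// lee_fin ltW.
- apply: ae_mono (ae_and (ae_and le_phi le_psi)
    (ae_and fE (ae_and Y_ge0 K_ge0))).
  move=> x [[l1 l2] [fx [[Y1 Y2] [k1 k2]]]] Ox.
  rewrite -addeA addeACA; apply: le_trans (leeD (l1 Ox) (l2 Ox)) _.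
  rewrite addeACA -EFinD (fx Ox) -ge0_muleDr; first by rewrite addeACA.
    exact: adde_ge0 (Y1 Ox) (k1 Ox).
  exact: adde_ge0 (Y2 Ox) (k2 Ox).
Qed.

Lemma eta2E Gh divh v r : eta2 Omega phi psi Gh divh v r =
  (\int[leb]_(x in Omega) efenchel_gap vdot (phi x) (Gh v x) (r x) +
   \int[leb]_(x in Omega) efenchel_gap sdot (psi x) (v x) (divh r x))%E.
Proof.
congr (_ + _)%E; apply: eq_integral => x _.
by rewrite /efenchel_gap /sdot (mulrC (divh r x)).
Qed.

Variable C : R.
Hypothesis C_gt0 : 0 < C.
Hypothesis est_phi :
  {ae leb, forall x, Omega x -> bregman_estimates vdot (phi x) C}.
Hypothesis est_psi :
  {ae leb, forall x, Omega x -> bregman_estimates sdot (psi x) C}.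

(** Bilinear expansion of the pairing of s - t with r - q. *)
Lemma null_mean_parts s t r : parts_relation Omega s r ->
  parts_relation Omega s q -> parts_relation Omega t r ->
  parts_relation Omega t q ->
  null_mean leb Omega (fun x => 2 *
    ((vdot (r x) (grad Omega s x) + s x * div Omega r x
      - (vdot (q x) (grad Omega s x) + s x * div Omega q x))
     - (vdot (r x) (grad Omega t x) + t x * div Omega r x
      - (vdot (q x) (grad Omega t x) + t x * div Omega q x)))).
Proof.
move=> sr sq tr tq; exact: (null_meanZ mO 2 (null_meanB mO (null_meanB mO sr sq)
  (null_meanB mO tr tq))).
Qed.

Variables (Gh : (space -> R) -> space -> space).
Variables (divh : (space -> space) -> space -> R).
Variables (v : space -> R) (r : space -> space).
Hypothesis v_meas :
  measurable_fun (Omega : set (leb_type R n)) (v : leb_type R n -> R) /\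
  measurable_vec Omega (Gh v).
Hypothesis r_meas : measurable_vec Omega r /\
  measurable_fun (Omega : set (leb_type R n)) (divh r : leb_type R n -> R).
Hypothesis uq : parts_relation Omega u q.

Lemma eta2_ge0 : (0 <= eta2 Omega phi psi Gh divh v r)%E.
Proof.
rewrite eta2E adde_ge0// integral_ge0// => x Ox.
  exact: efenchel_gap_ge0 (normal_proper hphi Ox) _ _.
exact: efenchel_gap_ge0 (normal_proper hpsi Ox) _ _.
Qed.

(** The pairing left over is that of s - u with r - q, all four conforming; div_h r
    is div r almost everywhere. *)
Lemma primal_bracket_estimate : Wdiv Omega r ->
  {ae leb, forall x, Omega x -> divh r x = div Omega r x} ->
  parts_relation Omega u r ->
  (rho_tot2 Omega phi psi Gh divh u q v r <=
   C%:E * (eta2 Omega phi psi Gh divh v r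
           + ereal_inf (primal_brackets Omega GammaD phi psi Gh q v r)))%E.
Proof.
move=> Wr divE ur; have [mv mGv] := v_meas; have [mr mdr] := r_meas.
have ev := vdot_euclidean R n; have es := sdot_euclidean R.
suff H B : primal_brackets Omega GammaD phi psi Gh q v r B ->
    (0 <= B /\ rho_tot2 Omega phi psi Gh divh u q v r <=
     C%:E * (eta2 Omega phi psi Gh divh v r + B))%E.
  by apply: lee_pmul_ereal_inf => // [|B /H[]|B /H[]//]; first exact: eta2_ge0.
move=> [s [g [k [[Ws _] [sr sq] [mg sg] [mk sk] ->]]]].
have [ms mgs] := W1_measurable Ws.
have bGv := measurable_vec_ball mO mGv; have bv := measurable_scalar_ball mO mv.
have bgs := measurable_vec_ball mO mgs; have bs := measurable_scalar_ball mO ms.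
have mK1 := emeasurable_bregman ev hphi bGv bgs
  (measurable_vdot mg (measurable_vecB mGv mgs)).
have mK2 := emeasurable_bregman es hpsi bv bs
  (measurable_funM mk (measurable_funB mv ms)).
have K1_ge0 : {ae leb, forall x, Omega x ->
    (0 <= bregman vdot (phi x) (g x) (Gh v x) (grad Omega s x))%E}.
  apply: ae_mono sg => x sg Ox.
  exact: bregman_subdiff_ge0 (normal_proper hphi Ox) (sg Ox).
have K2_ge0 : {ae leb, forall x, Omega x ->
    (0 <= bregman sdot (psi x) (k x) (v x) (s x))%E}.
  apply: ae_mono sk => x sk Ox.
  exact: bregman_subdiff_ge0 (normal_proper hpsi Ox) (sk Ox).
split.
  by rewrite adde_ge0//; apply: (ae_ge0_integral_ge0 mO).
rewrite eta2E; apply: (error_estimate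
    (f1 := fun x => 2 * vdot (grad Omega s x - grad Omega u x) (r x - q x))
    (f2 := fun x => 2 * sdot (s x - u x) (divh r x - div Omega q x))
    C_gt0 mGv mr mv mdr mK1 mK2 K1_ge0 K2_ge0
    (null_mean_parts sr sq ur uq)).
- apply: ae_mono divE => x divE Ox; rewrite (divE Ox) /sdot.
  rewrite (dotBl ev) !(dotBr ev) !(dotC ev (grad Omega _ x)); ring.
- apply: ae_mono (ae_and (ae_and est_phi sub_phi) sg) => x [[e1 e2] e3] Ox.
  exact: ((e1 Ox) _ _ _ _ (e2 Ox)).1 _ _ (e3 Ox).
- apply: ae_mono (ae_and (ae_and est_psi sub_psi) sk) => x [[e1 e2] e3] Ox.
  exact: ((e1 Ox) _ _ _ _ (e2 Ox)).1 _ _ (e3 Ox).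
Qed.

(** The pairing left over is that of v - u with s - q, all four conforming; G_h v
    is grad v almost everywhere. *)
Lemma dual_bracket_estimate : W1 1 Omega v ->
  {ae leb, forall x, Omega x -> Gh v x = grad Omega v x} ->
  parts_relation Omega v q ->
  (rho_tot2 Omega phi psi Gh divh u q v r <=
   C%:E * (eta2 Omega phi psi Gh divh v r
           + ereal_inf (dual_brackets Omega GammaD phi psi divh u v r)))%E.
Proof.
move=> Wv gradE vq; have [mv mGv] := v_meas; have [mr mdr] := r_meas.
have ev := vdot_euclidean R n; have es := sdot_euclidean R.
suff H B : dual_brackets Omega GammaD phi psi divh u v r B ->
    (0 <= B /\ rho_tot2 Omega phi psi Gh divh u q v r <=
     C%:E * (eta2 Omega phi psi Gh divh v r + B))%E.
  by apply: lee_pmul_ereal_inf => // [|B /H[]|B /H[]//]; first exact: eta2_ge0.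
move=> [s [g [k [[Ws _] [vs us] [mg sg] [mk sk] ->]]]].
have [ms mds] := Wdiv_measurable Ws.
have br := measurable_vec_ball mO mr; have bdr := measurable_scalar_ball mO mdr.
have bs := measurable_vec_ball mO ms; have bds := measurable_scalar_ball mO mds.
have mK1 := emeasurable_bregman_conj mO ev hphi br bs
  (measurable_vdot mg (measurable_vecB mr ms)).
have mK2 := emeasurable_bregman_conj mO es hpsi bdr bds
  (measurable_funM mk (measurable_funB mdr mds)).
have K1_ge0 : {ae leb, forall x, Omega x ->
    (0 <= bregman vdot (conj vdot (phi x)) (g x) (r x) (s x))%E}.
  apply: ae_mono (ae_and sg sub_phi) => x [sg' sp] Ox.
  apply: (bregman_subdiff_ge0 _ _ (sg' Ox)).
  split; first exact: (conj_neqNy (normal_proper hphi Ox)).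
  by exists (q x); exact: (subdiff_dom_conj ev (normal_proper hphi Ox) (sp Ox)).
have K2_ge0 : {ae leb, forall x, Omega x ->
    (0 <= bregman sdot (conj sdot (psi x)) (k x) (divh r x) (div Omega s x))%E}.
  apply: ae_mono (ae_and sk sub_psi) => x [sg' sp] Ox.
  apply: (bregman_subdiff_ge0 _ _ (sg' Ox)).
  split; first exact: (conj_neqNy (normal_proper hpsi Ox)).
  by exists (div Omega q x); exact: (subdiff_dom_conj es (normal_proper hpsi Ox) (sp Ox)).
split.
  by rewrite adde_ge0//; apply: (ae_ge0_integral_ge0 mO).
rewrite eta2E; apply: (error_estimate
    (f1 := fun x => 2 * vdot (Gh v x - grad Omega u x) (s x - q x))
    (f2 := fun x => 2 * sdot (v x - u x) (div Omega s x - div Omega q x))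
    C_gt0 mGv mr mv mdr mK1 mK2 K1_ge0 K2_ge0
    (null_mean_parts vs vq us uq)).
- apply: ae_mono gradE => x gradE Ox; rewrite (gradE Ox) /sdot.
  rewrite (dotBl ev) !(dotBr ev) !(dotC ev (grad Omega _ x)); ring.
- apply: ae_mono (ae_and (ae_and est_phi sub_phi) sg) => x [[e1 e2] e3] Ox.
  exact: ((e1 Ox) _ _ _ _ (e2 Ox)).2 _ _ (e3 Ox).
- apply: ae_mono (ae_and (ae_and est_psi sub_psi) sk) => x [[e1 e2] e3] Ox.
  exact: ((e1 Ox) _ _ _ _ (e2 Ox)).2 _ _ (e3 Ox).
Qed.

End error_estimate.

End problem.

Theorem theorem4p4 (R : realType) (Ceps : R -> R)
    (Ceps_gt0 : forall eps, 0 < eps -> 0 < Ceps eps) :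
  exists2 C : R, 0 < C &
  forall (n : nat) (Omega GammaD GammaN : set 'rV[R]_n.+1)
    (N : nat) (Th : 'I_N -> 'I_n.+2 -> 'rV[R]_n.+1) (sigma : R)
    (Gh : ('rV[R]_n.+1 -> R) -> 'rV[R]_n.+1 -> 'rV[R]_n.+1)
    (divh : ('rV[R]_n.+1 -> 'rV[R]_n.+1) -> 'rV[R]_n.+1 -> R)
    (phi : 'rV[R]_n.+1 -> 'rV[R]_n.+1 -> \bar R)
    (psi : 'rV[R]_n.+1 -> R -> \bar R)
    (u : 'rV[R]_n.+1 -> R) (q : 'rV[R]_n.+1 -> 'rV[R]_n.+1),
  lipschitz_domain Omega ->
  boundary_partition Omega GammaD GammaN ->
  conforming_triangulation Omega Th -> shape_regular sigma Th ->
  facets_compatible Omega GammaD GammaN Th ->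
  discrete_grad Omega Th Gh -> discrete_div Omega Th divh ->
  normal_convex_integrand Omega phi -> normal_convex_integrand Omega psi ->
  strong_duality Omega GammaD phi psi u q -> parts_relation Omega u q ->
  integrand_bregman_young vdot Omega Ceps phi ->
  integrand_bregman_young sdot Omega Ceps psi ->
  (forall v r, broken_W11 Omega Th v ->
     W1N Omega GammaD r -> parts_relation Omega u r ->
     (rho_tot2 Omega phi psi Gh divh u q v r <=
      C%:E * (eta2 Omega phi psi Gh divh v r
              + ereal_inf (primal_brackets Omega GammaD phi psi Gh q v r)))%E)
  /\
  (forall v r, W1D 1 Omega GammaD v -> parts_relation Omega v q ->
     broken_Wdiv Omega Th r ->
     (rho_tot2 Omega phi psi Gh divh u q v r <=
      C%:E * (eta2 Omega phi psi Gh divh v r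
              + ereal_inf (dual_brackets Omega GammaD phi psi divh u v r)))%E).
Proof.
have [C C0 est] := bregman_young_estimates Ceps_gt0.
exists C => // n Omega GammaD GammaN N Th sigma Gh divh phi psi u q.
move=> _ _ _ _ _ [Gh_L1 _ GhE] [divh_L1 _ divhE] hphi hpsi sd uq BYphi BYpsi.
have mO := measurable_domain hphi.
have [[[W1u _] [Wq _]] _ _ _] := sd.
have u_meas := W1_measurable W1u; have q_meas := Wdiv_measurable Wq.
have [sub_phi sub_psi] := strong_duality_subdiff hphi hpsi sd uq.
have est_phi : {ae leb, forall x, Omega x -> bregman_estimates vdot (phi x) C}.
  apply: ae_mono BYphi => x BY Ox; have [p c cl] := hphi.1 x Ox.
  exact: est (vdot_euclidean R n) p c cl (BY Ox).
have est_psi : {ae leb, forall x, Omega x -> bregman_estimates sdot (psi x) C}.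
  apply: ae_mono BYpsi => x BY Ox; have [p c cl] := hpsi.1 x Ox.
  exact: est (sdot_euclidean R) p c cl (BY Ox).
split=> [v r bv [Wr _] ur|v r [Wv _] vq br].
  have v_meas : measurable_fun (Omega : set (leb_type R n)) (v : leb_type R n -> R)
      /\ measurable_vec Omega (Gh v).
    by split; [exact: bv.1.1|move=> i; exact: (Gh_L1 v bv i).1].
  have [mr mdr] := Wdiv_measurable Wr.
  have mdhr : measurable_fun (Omega : set (leb_type R n))
      (divh r : leb_type R n -> R).
    apply: (ae_measurable_scalar mdr); apply: ae_mono (divhE r Wr).
    by move=> x dE Ox; rewrite dE.
  exact: (primal_bracket_estimate GammaD hphi hpsi u_meas q_meas sub_phi sub_psi
    C0 est_phi est_psi v_meas (Logic.conj mr mdhr) uq Wr (divhE r Wr) ur).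
have [mv mgv] := W1_measurable Wv.
have mGv : measurable_vec Omega (Gh v).
  apply: (ae_measurable_vec mgv); apply: ae_mono (GhE v Wv).
  by move=> x gE Ox; rewrite gE.
have r_meas : measurable_vec Omega r /\
    measurable_fun (Omega : set (leb_type R n)) (divh r : leb_type R n -> R).
  by split; [move=> i; exact: (br.1 i).1|exact: (divh_L1 r br).1].
exact: (dual_bracket_estimate GammaD hphi hpsi u_meas q_meas sub_phi sub_psi
  C0 est_phi est_psi (Logic.conj mv mGv) r_meas uq Wv (GhE v Wv) vq).
Qed.
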